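(* Let $\zeta:\mathcal{NB}_n\to\mathcal{LB}_n$ be the group homomorphism from the necklace braid group to the loop braid group given by $\tau\mapsto p:=s_1s_2\cdots s_{n-1}$, $\sigma_i\mapsto g_i$ for $i<n$, and $\sigma_n\mapsto p\,g_{n-1}\,p^{-1}$. Then the kernel of $\zeta$ is the order $2$ central subgroup $\langle\tau^n\rangle$.
   Context: The necklace braid group $\mathcal{NB}_n$ is the motion group in $\mathbb{R}^3$ of the necklace link consisting of $n$ pairwise unlinked Euclidean circles each linked to an auxiliary circle; it is presented by generators $\sigma_1,\dots,\sigma_n,\tau$ and relations, with all indices taken modulo $n$: (B1) $\sigma_i\sigma_{i+1}\sigma_i=\sigma_{i+1}\sigma_i\sigma_{i+1}$; (B2) $\sigma_i\sigma_j=\sigma_j\sigma_i$ whenever $i-j\not\equiv\pm1\pmod n$; (N1) $\tau\sigma_i\tau^{-1}=\sigma_{i+1}$ for $1\le i\le n$; (N2) $\tau^{2n}=1$. The loop braid group $\mathcal{LB}_n$ is the motion group of $n$ unlinked oriented circles in $\mathbb{R}^3$; it is presented by generators $g_1,\dots,g_{n-1},s_1,\dots,s_{n-1}$ and relations (whenever the indices make sense): $g_ig_{i+1}g_i=g_{i+1}g_ig_{i+1}$; $g_ig_j=g_jg_i$ for $|i-j|\ne1$; $s_i^2=1$; $s_is_{i+1}s_i=s_{i+1}s_is_{i+1}$; $s_is_j=s_js_i$ for $|i-j|\neq1$; $s_is_{i+1}g_i=g_{i+1}s_is_{i+1}$; $g_ig_{i+1}s_i=s_{i+1}g_ig_{i+1}$;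 $g_is_j=s_jg_i$ for $|i-j|>1$. *)

(* Defs.v *)
From HB Require Import structures.
From mathcomp Require Import all_boot.
From mathcomp Require Import boolp classical_sets cardinality.

Set Implicit Arguments.
Unset Strict Implicit.
Unset Printing Implicit Defensive.

Local Open Scope group_scope.
Local Open Scope classical_set_scope.
Local Open Scope quotient_scope.

(** * Groups given by generators and relations *)

Inductive gexpr (X : Type) : Type :=
  | Gen of X
  | One
  | Mul of gexpr X & gexpr X
  | Inv of gexpr X.
Arguments One {X}.

HB.instance Definition _ (X : Type) := gen_eqMixin (gexpr X).
HB.instance Definition _ (X : Type) := gen_choiceMixin (gexpr X).

(* [gexpr X] satisfies no group law; these instances only make the notations
   [x * y], [1], [x^-1] and [x ^+ n] available for writing relations. *)
HB.instance Definition _ (X : Type) := hasMul.Build (gexpr X) (@Mul X).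
HB.instance Definition _ (X : Type) := hasOne.Build (gexpr X) (@One X).
HB.instance Definition _ (X : Type) := hasInv.Build (gexpr X) (@Inv X).

Section Presentation.
Variables (X : Type) (R : gexpr X -> gexpr X -> Prop).

(* The least congruence that contains [R] and satisfies the group axioms. *)
Inductive pres_eq : gexpr X -> gexpr X -> Prop :=
  | pres_rel x y : R x y -> pres_eq x y
  | pres_refl x : pres_eq x x
  | pres_sym x y : pres_eq x y -> pres_eq y x
  | pres_trans x y z : pres_eq x y -> pres_eq y z -> pres_eq x z
  | pres_mul x x' y y' :
      pres_eq x x' -> pres_eq y y' -> pres_eq (x * y) (x' * y')
  | pres_inv x x' : pres_eq x x' -> pres_eq x^-1 x'^-1
  | pres_mulA x y z : pres_eq (x * (y * z)) (x * y * z)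
  | pres_mul1 x : pres_eq (1 * x) x
  | pres_mulr1 x : pres_eq (x * 1) x
  | pres_mulV x : pres_eq (x^-1 * x) 1
  | pres_mulrV x : pres_eq (x * x^-1) 1.

Definition pres_eqb : rel (gexpr X) := fun x y => `[< pres_eq x y >].

Lemma pres_eqb_refl : reflexive pres_eqb.
Proof. by move=> x; apply/asboolP; exact: pres_refl. Qed.

Lemma pres_eqb_sym : symmetric pres_eqb.
Proof. by move=> x y; apply: asbool_equiv_eq; split; exact: pres_sym. Qed.

Lemma pres_eqb_trans : transitive pres_eqb.
Proof.
move=> y x z /asboolP xy /asboolP yz; apply/asboolP; exact: pres_trans xy yz.
Qed.

Canonical pres_equiv :=
  EquivRel pres_eqb pres_eqb_refl pres_eqb_sym pres_eqb_trans.

Definition presented : Type := {eq_quot pres_equiv}.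

HB.instance Definition _ := Choice.on presented.
HB.instance Definition _ : EqQuotient (gexpr X) pres_eqb presented :=
  EqQuotient.on presented.

Definition pres_class (x : gexpr X) : presented := \pi_presented x.

Lemma pres_classP x y : pres_class x = pres_class y <-> pres_eq x y.
Proof.
split=> [/eqquotP/asboolP //|xy]; by apply/eqquotP/asboolP.
Qed.

Lemma pres_eq_repr x : pres_eq (repr (pres_class x)) x.
Proof. by apply/pres_classP; rewrite /pres_class reprK. Qed.

Definition pres_one : presented := pres_class 1.
Definition pres_op (a b : presented) : presented :=
  pres_class (repr a * repr b).
Definition pres_opp (a : presented) : presented := pres_class (repr a)^-1.

Lemma pres_opE x y :
  pres_op (pres_class x) (pres_class y) = pres_class (x * y).
Proof. by apply/pres_classP/pres_mul; exact: pres_eq_repr. Qed.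

Lemma pres_oppE x : pres_opp (pres_class x) = pres_class x^-1.
Proof. by apply/pres_classP/pres_inv; exact: pres_eq_repr. Qed.

Lemma pres_ind (P : presented -> Prop) :
  (forall x, P (pres_class x)) -> forall a, P a.
Proof. by move=> Px a; rewrite -[a]reprK; exact: Px. Qed.

Lemma pres_opA : associative pres_op.
Proof.
elim/pres_ind => x; elim/pres_ind => y; elim/pres_ind => z.
by rewrite !pres_opE; apply/pres_classP; exact: pres_mulA.
Qed.

Lemma pres_op1 : left_id pres_one pres_op.
Proof.
by elim/pres_ind => x; rewrite pres_opE; apply/pres_classP; exact: pres_mul1.
Qed.

Lemma pres_opr1 : right_id pres_one pres_op.
Proof.
by elim/pres_ind => x; rewrite pres_opE; apply/pres_classP; exact: pres_mulr1.
Qed.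

Lemma pres_opV : left_inverse pres_one pres_opp pres_op.
Proof.
elim/pres_ind => x; rewrite pres_oppE pres_opE.
by apply/pres_classP; exact: pres_mulV.
Qed.

Lemma pres_oprV : right_inverse pres_one pres_opp pres_op.
Proof.
elim/pres_ind => x; rewrite pres_oppE pres_opE.
by apply/pres_classP; exact: pres_mulrV.
Qed.

HB.instance Definition _ := isGroup.Build presented
  pres_opA pres_op1 pres_opr1 pres_opV pres_oprV.

Definition pres_gen (x : X) : presented := pres_class (Gen x).

End Presentation.

(* Index shift, used throughout: [i : 'I_n] stands for the index [i + 1] of the
   usual numbering 1, ..., n (and [i : 'I_n.-1] likewise for 1, ..., n - 1). *)

(** * The necklace braid group *)

Inductive nb_gen (n : nat) : Type :=
  | NBsigma of 'I_n
  | NBtau.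
Arguments NBtau {n}.

Section NecklaceRelations.
Variable n : nat.
Local Notation sg i := (Gen (NBsigma i)).
Local Notation ta := (Gen (@NBtau n)).

(* [ordS] is the cyclic successor, i.e. addition of 1 modulo n. *)
Inductive nb_rel : gexpr (nb_gen n) -> gexpr (nb_gen n) -> Prop :=
  | NB_B1 i : nb_rel (sg i * sg (ordS i) * sg i)
                     (sg (ordS i) * sg i * sg (ordS i))
  | NB_B2 i j : i <> ordS j -> j <> ordS i ->
      nb_rel (sg i * sg j) (sg j * sg i)
  | NB_N1 i : nb_rel (ta * sg i * ta^-1) (sg (ordS i))
  | NB_N2 : nb_rel (ta ^+ (2 * n)) 1.

End NecklaceRelations.

Definition NB (n : nat) : groupType := presented (@nb_rel n).
Definition sigma (n : nat) (i : 'I_n) : NB n := pres_gen (@nb_rel n) (NBsigma i).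
Definition tau (n : nat) : NB n := pres_gen (@nb_rel n) NBtau.

(** * The loop braid group *)

Inductive lb_gen (n : nat) : Type :=
  | LBg of 'I_n.-1
  | LBs of 'I_n.-1.

Section LoopRelations.
Variable n : nat.
Local Notation g i := (Gen (@LBg n i)).
Local Notation s i := (Gen (@LBs n i)).

Inductive lb_rel : gexpr (lb_gen n) -> gexpr (lb_gen n) -> Prop :=
  | LB_gg (i j : 'I_n.-1) : j = i.+1 :> nat ->
      lb_rel (g i * g j * g i) (g j * g i * g j)
  | LB_ggC (i j : 'I_n.-1) : j <> i.+1 :> nat -> i <> j.+1 :> nat ->
      lb_rel (g i * g j) (g j * g i)
  | LB_s2 i : lb_rel (s i ^+ 2) 1
  | LB_ss (i j : 'I_n.-1) : j = i.+1 :> nat ->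
      lb_rel (s i * s j * s i) (s j * s i * s j)
  | LB_ssC (i j : 'I_n.-1) : j <> i.+1 :> nat -> i <> j.+1 :> nat ->
      lb_rel (s i * s j) (s j * s i)
  | LB_ssg (i j : 'I_n.-1) : j = i.+1 :> nat ->
      lb_rel (s i * s j * g i) (g j * s i * s j)
  | LB_ggs (i j : 'I_n.-1) : j = i.+1 :> nat ->
      lb_rel (g i * g j * s i) (s j * g i * g j)
  | LB_gsC (i j : 'I_n.-1) : (i.+1 < j) || (j.+1 < i) ->
      lb_rel (g i * s j) (s j * g i).

End LoopRelations.

Definition LB (n : nat) : groupType := presented (@lb_rel n).
Definition gLB (n : nat) (i : 'I_n.-1) : LB n := pres_gen (@lb_rel n) (LBg i).
Definition sLB (n : nat) (i : 'I_n.-1) : LB n := pres_gen (@lb_rel n) (LBs i).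
Definition pLB (n : nat) : LB n := \prod_(i < n.-1) sLB i.

(** * The homomorphism and its kernel *)

Definition is_zeta (n : nat) (zeta : {multiplicative NB n -> LB n}) : Prop :=
  [/\ zeta (tau n) = pLB n,
      (forall (i : 'I_n) (j : 'I_n.-1), i = j :> nat ->
         zeta (sigma i) = gLB j)
    & (forall (i : 'I_n) (j : 'I_n.-1), i = n.-1 :> nat -> j = n.-2 :> nat ->
         zeta (sigma i) = pLB n * gLB j * (pLB n)^-1)].

Definition ker (G H : groupType) (f : {multiplicative G -> H}) : set G :=
  [set x | f x = 1].

Definition cyclic_subgroup (G : groupType) (x : G) : set G :=
  [set y | exists k : nat, y = x ^+ k \/ y = x ^- k].

Definition central (G : groupType) (A : set G) : Prop :=
  forall x y : G, A x -> commute x y.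

(* Main.v *)
(* The loop braid group acts on the free group on [x_0, ..., x_n] by the Artin
   automorphisms [g_i] and the transpositions [s_i]; only this action is used to
   detect elements outside the kernel.  With [A = sigma_0 ... sigma_(n-1)] and
   [z = A^-1 tau], the conjugates [y_j] of [z] acting as the inner automorphism
   by [x_j^-1] generate a subgroup [Y] normalised by
   [B = <sigma_0, ..., sigma_(n-1)>], and the necklace braid group is [Y B].  If
   [u b] acts trivially, with [u] the word [w] in the [y_j^-1], then [b] acts as
   conjugation by [w]; it fixes [delta = x_0 ... x_n], so [w] is a power of
   [delta].  Since [A^(n+1)] is [delta] evaluated at the [y_j^-1], times the
   central element [tau^(n+1)], up to a power of [tau^(n+1)] the element lies in
   [B], where Artin's faithfulness theorem applies.

   Artin's theorem is proved by combing: the braids on one more strand are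
   [Y' B' t_j], where [Y'] is generated by the same kind of chain, now starting
   from [sigma_k^2], and [t_j] are coset representatives.  Killing the last free
   generator detects first [t_j] and then [B']; an element of [Y'] is read off
   from the conjugate of the last generator to which it sends that generator. *)

From HB Require Import structures.
Require Import Defs.
From mathcomp Require Import all_boot zmodp.
From mathcomp Require Import boolp classical_sets cardinality.
From mathcomp Require Import zify.

Set Implicit Arguments.
Unset Strict Implicit.
Unset Printing Implicit Defensive.

Local Open Scope group_scope.

(** * Homomorphisms, presentations and bijections *)

Definition is_hom (G H : groupType) (f : G -> H) := {morph f : x y / x * y}.

Section Homomorphisms.
Variables (G H : groupType) (f : G -> H).
Hypothesis fM : is_hom f.

Lemma hom1 : f 1 = 1.
Proof. by apply: (mulgI (f 1)); rewrite -fM !mulg1. Qed.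

Lemma homV : {morph f : x / x^-1}.
Proof. by move=> x; apply: (mulgI (f x)); rewrite -fM !mulgV hom1. Qed.

Lemma homX k : {morph f : x / x ^+ k}.
Proof. by move=> x; elim: k => [|k IH]; rewrite ?hom1 // !expgS fM IH. Qed.

Lemma hom_prod (I : Type) (r : seq I) (E : I -> G) :
  f (\prod_(i <- r) E i) = \prod_(i <- r) f (E i).
Proof. exact: (big_morph f fM hom1). Qed.

End Homomorphisms.

Definition gexpr_eval (X : Type) (G : groupType) (f : X -> G) :=
  fix eval (e : gexpr X) : G :=
  match e with
  | Gen a => f a
  | One => 1
  | Mul a b => eval a * eval b
  | Inv a => (eval a)^-1
  end.

Lemma gexpr_evalX (X : Type) (G : groupType) (f : X -> G) e k :
  gexpr_eval f (e ^+ k) = gexpr_eval f e ^+ k.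
Proof.
case: k => // k; elim: k => // k IH.
by rewrite expgS -IH.
Qed.

Section UniversalProperty.
Variables (X : Type) (R : gexpr X -> gexpr X -> Prop) (G : groupType).
Variable f : X -> G.
Hypothesis fR : forall x y, R x y -> gexpr_eval f x = gexpr_eval f y.

Lemma pres_eq_eval x y : pres_eq R x y -> gexpr_eval f x = gexpr_eval f y.
Proof.
elim=> {x y} //=.
- by move=> x y z _ -> _ ->.
- by move=> x x' y y' _ -> _ ->.
- by move=> x x' _ ->.
- by move=> x y z; rewrite mulgA.
- by move=> x; rewrite mul1g.
- by move=> x; rewrite mulg1.
- by move=> x; rewrite mulVg.
- by move=> x; rewrite mulgV.
Qed.

Definition pres_lift (z : presented R) : G := gexpr_eval f (repr z).

Lemma pres_lift_class e : pres_lift (pres_class R e) = gexpr_eval f e.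
Proof. by apply: pres_eq_eval; apply: pres_eq_repr. Qed.

Lemma pres_liftM : is_hom pres_lift.
Proof.
elim/pres_ind => x; elim/pres_ind => y.
by rewrite [_ * _]pres_opE !pres_lift_class.
Qed.

Lemma pres_liftE a : pres_lift (pres_gen R a) = f a.
Proof. exact: pres_lift_class. Qed.

End UniversalProperty.

(** * Subgroups generated by a set *)

Inductive gen (G : groupType) (S : G -> Prop) : G -> Prop :=
  | gen_incl x : S x -> gen S x
  | gen1 : gen S 1
  | genM x y : gen S x -> gen S y -> gen S (x * y)
  | genV x : gen S x -> gen S x^-1.

Lemma genX (G : groupType) (S : G -> Prop) x k : gen S x -> gen S (x ^+ k).
Proof.
by move=> Sx; elim: k => [|k IH]; [exact: gen1 | rewrite expgS; apply: genM].
Qed.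

Lemma gen_prod (G : groupType) (S : G -> Prop) (a b : nat) (s : nat -> G) :
  (forall i, (a <= i < b)%N -> gen S (s i)) -> gen S (\prod_(a <= i < b) s i).
Proof.
move=> sS; rewrite big_nat_cond; apply: big_ind; [exact: gen1|exact: genM|].
by move=> i /andP[/sS].
Qed.

Lemma gen_presented (X : Type) (R : gexpr X -> gexpr X -> Prop) x :
  gen (range (pres_gen R)) x.
Proof.
elim/pres_ind: x => e; elim: e => [a||a IHa b IHb|a IHa].
- by apply: gen_incl; exists a.
- exact: gen1.
- by have := genM IHa IHb; rewrite [_ * _]pres_opE.
- by have := genV IHa; rewrite [_^-1]pres_oppE.
Qed.

Lemma gen_eq (G H : groupType) (f g : G -> H) (S : G -> Prop) x :
  is_hom f -> is_hom g -> (forall y, S y -> f y = g y) -> gen S x -> f x = g x.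
Proof.
move=> fM gM fg; elim=> {x} [y /fg //||y z _ IHy _ IHz|y _ IHy].
- by rewrite (hom1 fM) (hom1 gM).
- by rewrite fM gM IHy IHz.
- by rewrite (homV fM) (homV gM) IHy.
Qed.

Lemma gen_commute (G : groupType) (S : G -> Prop) (c x : G) :
  (forall y, S y -> commute c y) -> gen S x -> commute c x.
Proof.
move=> cS; elim=> {x} [y /cS //||y z _ cy _ cz|y _ cy].
- exact: commute1.
- exact: commuteM.
- exact: commuteV.
Qed.

(** * The group of bijections of a type *)

Section Bijections.
Variable T : Type.

(** The inverse is a field so that group inversion just swaps the two maps; [bij_ext] shows that the
    first map determines it. *)
Record bij := Bij {
  bij_fun :> T -> T;
  bij_inv : T -> T;
  bij_funK : cancel bij_fun bij_inv;
  bij_invK : cancel bij_inv bij_fun }.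

Lemma bij_ext (f g : bij) : f =1 g -> f = g.
Proof.
case: f g => f f' fK f'K [g g' gK g'K] /= /funext fg.
have {fg} : f = g by [].
move=> fg; subst g.
have f'g' : f' = g' by apply/funext => y; rewrite -{1}[y]g'K fK.
by subst g'; rewrite (Prop_irrelevance fK gK) (Prop_irrelevance f'K g'K).
Qed.

HB.instance Definition _ := gen_eqMixin bij.
HB.instance Definition _ := gen_choiceMixin bij.

Definition bij_one := @Bij id id (fun _ => erefl) (fun _ => erefl).
Definition bij_mul (f g : bij) :=
  Bij (can_comp (@bij_funK f) (@bij_funK g))
      (can_comp (@bij_invK g) (@bij_invK f)).
Definition bij_opp (f : bij) := Bij (@bij_invK f) (@bij_funK f).

Lemma bij_mulA : associative bij_mul. Proof. by move=> f g h; exact: bij_ext. Qed.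
Lemma bij_mul1 : left_id bij_one bij_mul. Proof. by move=> f; exact: bij_ext. Qed.
Lemma bij_mulr1 : right_id bij_one bij_mul. Proof. by move=> f; exact: bij_ext. Qed.
Lemma bij_mulV : left_inverse bij_one bij_opp bij_mul.
Proof. by move=> f; apply: bij_ext => x /=; rewrite bij_funK. Qed.
Lemma bij_mulrV : right_inverse bij_one bij_opp bij_mul.
Proof. by move=> f; apply: bij_ext => x /=; rewrite bij_invK. Qed.

HB.instance Definition _ :=
  isGroup.Build bij bij_mulA bij_mul1 bij_mulr1 bij_mulV bij_mulrV.

Lemma bijM (f g : bij) x : (f * g) x = f (g x). Proof. by []. Qed.
Lemma bij1 x : (1 : bij) x = x. Proof. by []. Qed.
Lemma bijVK (f : bij) x : f^-1 (f x) = x. Proof. exact: bij_funK. Qed.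
Lemma bijKV (f : bij) x : f (f^-1 x) = x. Proof. exact: bij_invK. Qed.

End Bijections.

Lemma is_hom1 (G : groupType) : is_hom (1 : bij G).
Proof. by []. Qed.

Lemma is_homM (G : groupType) (f g : bij G) : is_hom f -> is_hom g -> is_hom (f * g).
Proof. by move=> fM gM x y; rewrite !bijM gM fM. Qed.

Lemma is_homV (G : groupType) (f : bij G) : is_hom f -> is_hom f^-1.
Proof.
by move=> fM x y; apply: (can_inj (bij_funK f)); rewrite fM !bijKV.
Qed.
(** * Free groups and reduced words *)

Section FreeGroup.
Variable X : eqType.

Definition no_rel (_ _ : gexpr X) : Prop := False.
Definition free : groupType := presented no_rel.
Definition fgen (a : X) : free := pres_gen no_rel a.

Section FreeLift.
Variables (G : groupType) (f : X -> G).

Lemma no_relP x y : no_rel x y -> gexpr_eval f x = gexpr_eval f y.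
Proof. by []. Qed.

Definition free_lift : free -> G := @pres_lift X no_rel G f.

Lemma free_liftM : is_hom free_lift. Proof. exact: pres_liftM no_relP. Qed.

Lemma free_liftE a : free_lift (fgen a) = f a.
Proof. exact: (pres_liftE no_relP). Qed.

End FreeLift.

Lemma free_gen w : gen (range fgen) w.
Proof. exact: gen_presented. Qed.

Lemma free_hom_ext (G : groupType) (f g : free -> G) :
  is_hom f -> is_hom g -> (forall a, f (fgen a) = g (fgen a)) -> f =1 g.
Proof.
by move=> fM gM fg w; apply: (gen_eq fM gM _ (free_gen w)) => _ [a _ <-].
Qed.

(* A letter [(a, true)] stands for [a] and [(a, false)] for its inverse. *)
Definition flip (l : X * bool) := (l.1, ~~ l.2).
Definition reduced (r : seq (X * bool)) := sorted (fun l l' => l' != flip l) r.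
Definition push (l : X * bool) r :=
  if r is l' :: r' then if l' == flip l then r' else l :: r else [:: l].

Lemma flipK : involutive flip.
Proof. by case=> a b; rewrite /flip /= negbK. Qed.

Lemma push_reduced l r : reduced r -> reduced (push l r).
Proof.
case: r => //= l' r r'; case: eqP => [_|/eqP ne]; first exact: path_sorted r'.
by rewrite /= ne.
Qed.

Lemma pushK l r : reduced r -> push (flip l) (push l r) = r.
Proof.
case: r => [|l' r] /=; first by rewrite flipK eqxx.
case: eqP => [->|_ _] /=; last by rewrite flipK eqxx.
by case: r => //= l'' r /andP[/negPf->].
Qed.

Definition rword := {r : seq (X * bool) | reduced r}.
Definition rpush l (r : rword) : rword :=
  exist (fun r => reduced r) (push l (val r)) (push_reduced l (valP r)).

Lemma rpushK l : cancel (rpush l) (rpush (flip l)).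
Proof. by move=> r; apply: val_inj; apply: pushK; apply: valP. Qed.

Lemma rpushVK l : cancel (rpush (flip l)) (rpush l).
Proof. by move=> r; rewrite -{1}[l]flipK rpushK. Qed.

(** Van der Waerden's trick: the free group acts on reduced words by left multiplication, which
    yields normal forms without a confluence argument. *)
Definition rpush_bij a : bij rword := Bij (@rpushK (a, true)) (@rpushVK (a, true)).
Definition nf_act := free_lift rpush_bij.

Definition letter (l : X * bool) := if l.2 then fgen l.1 else (fgen l.1)^-1.
Definition word_val r := \prod_(l <- r) letter l.

Lemma letter_flip l : letter (flip l) = (letter l)^-1.
Proof. by case: l => a []; rewrite /letter ?invgK. Qed.

Lemma word_val_cons l r : word_val (l :: r) = letter l * word_val r.
Proof. by rewrite /word_val big_cons. Qed.

Lemma word_val_push l r : word_val (push l r) = letter l * word_val r.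
Proof.
case: r => [|l' r] /=; first by rewrite word_val_cons.
case: eqP => [->|_]; rewrite !word_val_cons //.
by rewrite letter_flip mulVKg.
Qed.

Lemma word_val_act w (r : rword) :
  word_val (val (nf_act w r)) = w * word_val (val r).
Proof.
rewrite /nf_act; have actM := free_liftM rpush_bij.
elim: (free_gen w) r => {w} [_ [a _ <-]||x y _ IHx _ IHy|x _ IHx] r.
- by rewrite free_liftE /= word_val_push.
- by rewrite (hom1 actM) mul1g.
- by rewrite actM bijM IHx IHy mulgA.
- by rewrite (homV actM) -{2}[r](bijKV (free_lift rpush_bij x)) IHx mulKg.
Qed.

Definition rnil : rword := exist (fun r => reduced r) [::] isT.

(** No push cancels while a reduced word is rebuilt letter by letter from the empty word. *)
Lemma nf_act_word (r : rword) : nf_act (word_val (val r)) rnil = r.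
Proof.
rewrite /nf_act; have actM := free_liftM rpush_bij.
case: r => r rr; apply: val_inj => /=.
elim: r rr => [|l r IH] rr; first by rewrite /word_val big_nil (hom1 actM).
have letterE (t : rword) : free_lift rpush_bij (letter l) t = rpush l t.
  case: l {IH rr} => a [] /=; rewrite /letter /=; first by rewrite free_liftE.
  by rewrite (homV actM) free_liftE.
rewrite word_val_cons actM bijM letterE /= IH; last exact: path_sorted rr.
by case: r rr {IH} => //= l' r /andP[/negPf->].
Qed.

Lemma reduced_inj r r' :
  reduced r -> reduced r' -> word_val r = word_val r' -> r = r'.
Proof.
move=> rr rr' e.
have := nf_act_word (exist (fun r => reduced r) r rr); rewrite /= e.
by rewrite (nf_act_word (exist (fun r => reduced r) r' rr')) => -[].
Qed.

Lemma reducedP w : exists2 r, reduced r & word_val r = w.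
Proof.
exists (val (nf_act w rnil)); first exact: valP.
by rewrite word_val_act /word_val big_nil mulg1.
Qed.

Lemma fgen_neq1 a : fgen a <> 1.
Proof.
move=> e; have : [:: (a, true)] = [::] by
  apply: reduced_inj; rewrite // /word_val big_seq1 big_nil.
by [].
Qed.

(** Induction on the length of a reduced word for [w]. A first letter [a] or [a^-1] is stripped; any
    other first letter makes [a w] reduced, and comparison with [w a] gives a contradiction. *)
Lemma commute_fgen a w :
  commute w (fgen a) -> cyclic_subgroup (fgen a) w.
Proof.
have [r rr <-] := reducedP w; elim: {r}(size r) {-2}r (leqnn (size r)) rr.
  by case=> // _ _ _; exists 0%N; left; rewrite /word_val big_nil.
move=> k IH [_ _ _|l r rk rr c]; first by exists 0%N; left; rewrite /word_val big_nil.
have [la|la] := eqVneq l.1 a.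
  have lr : letter l = fgen a \/ letter l = (fgen a)^-1.
    by case: l {rk rr c} la => b [] /= ->; rewrite /letter /=; [left|right].
  have cl : commute (fgen a) (letter l).
    by case: lr => ->; [|apply: commuteV]; exact: commute_refl.
  have c' : commute (word_val r) (fgen a).
    rewrite -[word_val r](mulKg (letter l)) -word_val_cons.
    apply: commute_sym; apply: commuteM; first exact: commuteV.
    exact: commute_sym.
  have [j jr] := IH r rk (path_sorted rr) c'.
  rewrite word_val_cons; case: lr jr => -> [] ->.
  - by exists j.+1; left; rewrite expgS.
  - case: j => [|j]; first by exists 1%N; left; rewrite expg0 invg1 mulg1 expg1.
    by exists j; right; rewrite expgSr invgM mulVKg.
  - case: j => [|j]; first by exists 1%N; right; rewrite expg0 mulg1 expg1.
    by exists j; left; rewrite expgS mulKg.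
  - by exists j.+1; right; rewrite expgSr invgM.
set s := l :: r in rr c rk *.
have as_red : reduced ((a, true) :: s).
  move: rr; rewrite /reduced /= => ->; rewrite andbT; apply/eqP => e.
  by rewrite e /= eqxx in la.
have e1 : word_val ((a, true) :: s) = word_val s * fgen a.
  by rewrite word_val_cons c.
have [s' [l' ss']] : exists s' l', s = rcons s' l'.
  by rewrite /s lastI; exists (belast l r), (last l r).
have e2 : word_val s = word_val s' * letter l'.
  by rewrite ss' /word_val -cats1 big_cat big_seq1.
(* If [w] ends in [a^-1], then [w a] reduces to the shorter word [s'], whereas [a w] is longer than
   [w]. *)
have [l'E|l'E] := eqVneq l' (a, false).
  have rs' : reduced s' by move: rr; rewrite ss' /reduced -cats1; by case/cat_sorted2.
  have : (a, true) :: s = s'.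
    apply: reduced_inj => //; rewrite e1 e2 l'E /letter /=.
    by rewrite -mulgA mulVg mulg1.
  move/(congr1 size); rewrite ss' /= size_rcons; lia.
(* Otherwise [w a] is reduced too, and equality of normal forms forces [w] to begin with [a]. *)
have : (a, true) :: s = rcons s (a, true).
  apply: reduced_inj => //.
    rewrite ss' -cats1 /reduced; move: rr; rewrite ss' /reduced.
    case: s' {ss' e2} => [|b s'] /=.
      by rewrite !andbT => _; apply: contra l'E => /eqP[]; case: (l') => ? [] //= <-.
    rewrite cat_path => -> /=; rewrite last_rcons andbT.
    by apply: contra l'E => /eqP[]; case: (l') => ? [] //= <-.
  by rewrite e1 /word_val -cats1 big_cat big_seq1.
by rewrite /s /= => -[] /(congr1 fst) /= ale; rewrite ale eqxx in la.
Qed.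

End FreeGroup.

(** * Braid relations and Hurwitz chains *)

Lemma down_ind (k : nat) (P : nat -> Prop) :
  P k -> (forall j, (j < k)%N -> P j.+1 -> P j) -> forall j, (j <= k)%N -> P j.
Proof.
move=> Pk PS j jk; rewrite -(subKn jk).
elim: (k - j)%N (leq_subr j k) => [|d IH] dk; first by rewrite subn0.
by apply: PS; [lia|rewrite subnSK //; apply: IH; lia].
Qed.

Section GroupFacts.
Variable G : groupType.
Implicit Types x y z d : G.

Lemma commuteJ x y z : commute x y -> commute (x ^ z) (y ^ z).
Proof. by move=> xy; rewrite /commute -!conjMg xy. Qed.

Lemma conjV_eq d x y : d * x = y * d -> x ^ d^-1 = y.
Proof. by rewrite /conjg invgK mulgA => ->; rewrite mulgK. Qed.

Lemma commute_conj x y : commute x y -> x ^ y = x.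
Proof. by move=> xy; rewrite /conjg xy mulKg. Qed.

Lemma commute_conjV x y : commute x y -> x ^ y^-1 = x.
Proof. by move=> xy; apply: commute_conj; exact: commuteV. Qed.

Lemma commute_prod_nat x (a b : nat) (s : nat -> G) :
  (forall i, (a <= i < b)%N -> commute x (s i)) ->
  commute x (\prod_(a <= i < b) s i).
Proof.
move=> sC; rewrite big_nat_cond; apply: commute_prod => i.
by rewrite andbT; exact: sC.
Qed.

Lemma prod_nat_split (a m b : nat) (s : nat -> G) : (a <= m <= b)%N ->
  \prod_(a <= i < b) s i = (\prod_(a <= i < m) s i) * \prod_(m <= i < b) s i.
Proof. by case/andP=> am mb; rewrite (big_cat_nat am mb). Qed.

Lemma gen_conj (S : G -> Prop) x d :
  (forall y, S y -> gen S (y ^ d)) -> gen S x -> gen S (x ^ d).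
Proof.
move=> Sd; elim=> {x} [y /Sd //||x y _ Sx _ Sy|x _ Sx].
- by rewrite conj1g; exact: gen1.
- by rewrite conjMg; exact: genM.
- by rewrite conjVg; exact: genV.
Qed.

Lemma gen_normal (S T : G -> Prop) d :
  (forall c y, T c -> S y -> gen S (y ^ c) /\ gen S (y ^ c^-1)) ->
  gen T d -> forall x, gen S x -> gen S (x ^ d).
Proof.
(* Both directions are carried along because the inverse case of the induction on [d] exchanges
   them. *)
move=> STn Td; suff [] : (forall x, gen S x -> gen S (x ^ d)) /\
  (forall x, gen S x -> gen S (x ^ d^-1)) by [].
elim: Td => {d} [c Tc||c d _ [Sc ScV] _ [Sd SdV]|c _ [Sc ScV]].
- by split=> x; apply: gen_conj => y Sy; case: (STn c y Tc Sy).
- by rewrite invg1; split=> x; rewrite conjg1.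
- by rewrite invgM; split=> x Sx; rewrite conjgM; auto.
- by rewrite invgK.
Qed.

End GroupFacts.

Section NormalProduct.
Variables (G : groupType) (S T : G -> Prop).
Hypothesis STn : forall d, gen T d -> forall x, gen S x -> gen S (x ^ d).

Definition gen_mul (x : G) := exists u b, [/\ gen S u, gen T b & x = u * b].

Lemma gen_mull x : gen S x -> gen_mul x.
Proof. by move=> Sx; exists x, 1; split; rewrite ?mulg1 //; exact: gen1. Qed.

Lemma gen_mulr x : gen T x -> gen_mul x.
Proof. by move=> Tx; exists 1, x; split; rewrite ?mul1g //; exact: gen1. Qed.

Lemma gen_mulM x y : gen_mul x -> gen_mul y -> gen_mul (x * y).
Proof.
move=> [u [b [Su Tb ->]]] [v [c [Sv Tc ->]]].
exists (u * v ^ b^-1), (b * c); split; first by apply/genM/STn/Sv/genV.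
  exact: genM.
by rewrite /conjg invgK !mulgA mulgVK.
Qed.

Lemma gen_mulV x : gen_mul x -> gen_mul x^-1.
Proof.
move=> [u [b [Su Tb ->]]]; rewrite invgM; apply: gen_mulM.
  exact/gen_mulr/genV.
exact/gen_mull/genV.
Qed.

End NormalProduct.

Section ShiftingProduct.
Variables (G : groupType) (m : nat) (s a : nat -> G).
Hypothesis saC : forall i j, (i < m)%N -> (j < m)%N ->
  (i.+1 < j)%N || (j.+1 < i)%N -> commute (a i) (s j).
Hypothesis ssa : forall i, (i.+1 < m)%N ->
  s i * s i.+1 * a i = a i.+1 * s i * s i.+1.

(** Moving left, [a_i] commutes with the factors beyond [s_(i+1)], becomes [a_(i+1)] at
    [s_i s_(i+1)], and commutes with the rest. Two families are allowed so that both the pure and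
    the mixed braid relations are covered. *)
Lemma shift_prod i : (i.+1 < m)%N ->
  (\prod_(0 <= j < m) s j) * a i = a i.+1 * \prod_(0 <= j < m) s j.
Proof.
move=> im.
have -> : \prod_(0 <= j < m) s j =
    (\prod_(0 <= j < i) s j) * (s i * s i.+1) * \prod_(i.+2 <= j < m) s j.
  rewrite (@prod_nat_split _ 0 i m); last by lia.
  by rewrite (@big_ltn _ _ _ i) ?(ltnW im) // (@big_ltn _ _ _ i.+1) // !mulgA.
have c1 : commute (a i) (\prod_(i.+2 <= j < m) s j).
  by apply: commute_prod_nat => j /andP[ij jm]; apply: saC; lia.
have c2 : commute (a i.+1) (\prod_(0 <= j < i) s j).
  by apply: commute_prod_nat => j /andP[_ ji]; apply: saC; lia.
rewrite -mulgA -c1 !mulgA c2; congr (_ * _).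
by rewrite -!mulgA; congr (_ * _); rewrite !mulgA ssa.
Qed.

End ShiftingProduct.

Definition braided (G : groupType) (k : nat) (s : nat -> G) :=
  (forall i, (i.+1 < k)%N -> s i * s i.+1 * s i = s i.+1 * s i * s i.+1) /\
  (forall i j, (i.+1 < j)%N -> (j < k)%N -> commute (s i) (s j)).

Lemma braidedW (G : groupType) (k l : nat) (s : nat -> G) :
  (k <= l)%N -> braided l s -> braided k s.
Proof.
move=> kl [b c]; split=> [i ik|i j ij jk]; first by apply: b; lia.
by apply: c; lia.
Qed.

Section Braided.
Variables (G : groupType) (m : nat) (s : nat -> G).
Hypothesis sB : braided m s.

Lemma braidedC i j : (i < m)%N -> (j < m)%N ->
  (i.+1 < j)%N || (j.+1 < i)%N -> commute (s i) (s j).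
Proof.
move=> im jm /orP[] ij; first by apply: sB.2.
by apply: commute_sym; apply: sB.2.
Qed.

Lemma braided_shift i : (i.+1 < m)%N ->
  (\prod_(0 <= j < m) s j) * s i = s i.+1 * \prod_(0 <= j < m) s j.
Proof.
apply: (@shift_prod _ _ s s); first exact: braidedC.
exact: sB.1.
Qed.

Lemma braided_shift_prod a b : (b < m)%N ->
  (\prod_(0 <= j < m) s j) * (\prod_(a <= i < b) s i) =
  (\prod_(a.+1 <= i < b.+1) s i) * \prod_(0 <= j < m) s j.
Proof.
move=> bm; have [ab|ba] := leqP a b; last first.
  by rewrite (@big_geq _ _ _ a) 1?(@big_geq _ _ _ a.+1) ?mul1g ?mulg1 //; lia.
elim/down_ind: ab => [|j jb IH].
  by rewrite (@big_geq _ _ _ b) 1?(@big_geq _ _ _ b.+1) ?mul1g ?mulg1.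
rewrite (@big_ltn _ _ _ j) // (@big_ltn _ _ _ j.+1 b.+1) //.
rewrite mulgA braided_shift; last exact: leq_ltn_trans bm.
by rewrite -!mulgA IH.
Qed.

End Braided.

(** The order of a Coxeter element of the symmetric group on [m+1] letters divides [m+1]. *)
Lemma coxeter_power (G : groupType) (m : nat) (s : nat -> G) :
  braided m s -> (forall i, (i < m)%N -> s i * s i = 1) ->
  (\prod_(0 <= i < m) s i) ^+ m.+1 = 1.
Proof.
elim: m => [|m IH] sB s2; first by rewrite big_geq // expg1n.
have {}IH := IH (braidedW (leqnSn m) sB) (fun i im => s2 i (ltnW im)).
set P := \prod_(0 <= i < m.+1) s i; set P' := \prod_(0 <= i < m) s i in IH.
have PE : P = P' * s m by rewrite /P big_nat_recr.
(* At [j = m+1] the second factor is [P] itself, so [P^(m+2) = P'^(m+1)], which is 1 by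
   induction. *)
have key j : (j <= m.+1)%N -> P ^+ j * \prod_(m.+1 - j <= i < m.+1) s i = P' ^+ j.
  elim: j => [|j IHj] jm; first by rewrite subn0 big_geq // mulg1.
  rewrite [in RHS]expgSr -(IHj (ltnW jm)) expgSr -!mulgA; congr (_ * _).
  have -> : P' = P * s m by rewrite PE -mulgA s2 // mulg1.
  rewrite big_nat_recr /=; last by lia.
  rewrite mulgA (braided_shift_prod sB) // -mulgA; congr (_ * _).
  by congr (bigop _ _ _); congr index_iota; lia.
by have := key m.+1 (leqnn _); rewrite subnn -/P -expgSr => ->.
Qed.

Section Hurwitz.
Variables (G : groupType) (k : nat) (s : nat -> G) (z : G).
Hypothesis sB : braided k s.
Hypothesis zC : forall i, (i.+1 < k)%N -> commute z (s i).
Hypothesis zs : forall i, i.+1 = k -> s i * z * s i * z = z * s i * z * s i.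

(* The chain [hz k = z], [hz j = s_j * hz (j + 1) * s_j^-1]; locked because
   rewriting with [mulgA] would otherwise unfold the conjugation. *)
Definition hz j := locked (z ^ (\prod_(j <= i < k) s i)^-1).

Lemma hzE j : hz j = z ^ (\prod_(j <= i < k) s i)^-1.
Proof. by rewrite /hz -lock. Qed.

Lemma hzk : hz k = z.
Proof. by rewrite hzE big_geq // invg1 conjg1. Qed.

Lemma hzS j : (j < k)%N -> hz j = hz j.+1 ^ (s j)^-1.
Proof. by move=> jk; rewrite !hzE [in LHS]big_ltn // invgM conjgM. Qed.

Lemma hzSM j : (j < k)%N -> s j * hz j.+1 = hz j * s j.
Proof. by move=> jk; rewrite (hzS jk) /conjg invgK !mulgA mulgVK. Qed.

Lemma hz_commute_lt i j : (i.+1 < j)%N -> (j <= k)%N -> commute (hz j) (s i).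
Proof.
move=> ij jk; rewrite hzE -[s i](@commute_conjV _ _ (\prod_(j <= i < k) s i)).
  by apply/commuteJ/zC; lia.
by apply: commute_prod_nat => l /andP[jl lk]; apply: sB.2; lia.
Qed.

(** The essential case [i = j+1] is the commutation of [hz (j+2)] with [s_j], conjugated by
    [s_j s_(j+1)]; larger [i] follow by conjugating with [s_j]. *)
Lemma hz_commute_gt i j : (j < i)%N -> (i < k)%N -> commute (hz j) (s i).
Proof.
move=> ji ik; have jk : (j <= k)%N by lia.
elim/down_ind: jk i ji ik => [i|{}j jk IH i ji ik]; first by lia.
have [ij|ij] := eqVneq i j.+1; last first.
  rewrite hzS // -[s i](@commute_conjV _ _ (s j)); last first.
    by apply/commute_sym; apply: sB.2; lia.
  by apply: commuteJ; apply: IH; lia.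
subst i; have c : commute (hz j.+2) (s j) by apply: hz_commute_lt.
have e1 : hz j.+2 ^ (s j * s j.+1)^-1 = hz j.
  by rewrite invgM conjgM -hzS // -hzS.
have e2 : s j ^ (s j * s j.+1)^-1 = s j.+1.
  by apply: conjV_eq; rewrite sB.1 // !mulgA.
by have := commuteJ (s j * s j.+1)^-1 c; rewrite e1 e2.
Qed.

(** The Hurwitz move preserves the product of two neighbours. For [i = k-1] this is the type B
    relation [zs]; conjugation by [s_(i+1) s_i] then lowers the index. *)
Lemma hz_commuteM i : (i < k)%N -> commute (s i) (hz i.+1 * hz i).
Proof.
move=> ik; have ik' : (i <= k.-1)%N by lia.
elim/down_ind: ik' ik => [|{}i ik' IH] ik.
  have e : k.-1.+1 = k by lia.
  have := zs e; have := hzSM ik; rewrite e hzk => h1 h2.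
  rewrite /commute; apply: (mulIg (s k.-1)).
  rewrite -[z * hz _ * _]mulgA -mulgA -[z * _ * _]mulgA -h1 !mulgA h2.
  by rewrite -[z * _ * z]mulgA h1 !mulgA.
have {}IH : commute (s i.+1) (hz i.+2 * hz i.+1) by apply: IH; lia.
pose d := s i.+1 * s i.
have d1 : s i.+1 ^ d^-1 = s i.
  by apply: conjV_eq; rewrite /d mulgA -sB.1 //; lia.
have d2 : hz i.+2 ^ d^-1 = hz i.+1.
  rewrite /d invgM conjgM (commute_conjV (hz_commute_lt _ _)) //; last by lia.
  by rewrite [in RHS]hzS //; lia.
have d3 : hz i.+1 ^ d^-1 = hz i.
  rewrite /d invgM conjgM -hzS //; apply: commute_conjV.
  by apply: hz_commute_gt => //; lia.
by have := commuteJ d^-1 IH; rewrite conjMg d1 d2 d3.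
Qed.

Definition hz_set y := exists2 j, (j <= k)%N & y = hz j.
Definition s_set y := exists2 i, (i < k)%N & y = s i.

(** Up to conjugation inside the chain, [s_i] exchanges [hz i] and [hz (i+1)], and it commutes with
    the other members. *)
Lemma hz_normal d : gen s_set d -> forall x, gen hz_set x -> gen hz_set (x ^ d).
Proof.
apply: gen_normal => _ _ [i ik ->] [j jk ->].
have hzg l : (l <= k)%N -> gen hz_set (hz l) by move=> lk; apply: gen_incl; exists l.
have [ij|ij] := eqVneq i j.
  subst j; split; last first.
    have -> : hz i ^ (s i)^-1 = (hz i)^-1 * hz i.+1 * hz i.
      apply: conjV_eq; apply: (mulgI (hz i)).
      rewrite [LHS]mulgA -hzSM // -[LHS]mulgA (hz_commuteM ik).
      by rewrite !mulgA mulgV mul1g.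
    by apply: genM; [apply: genM; [exact/genV/hzg|exact: hzg]|exact: hzg].
  have -> : hz i ^ s i = hz i.+1 by rewrite hzS // conjgKV.
  exact: hzg.
have [ij1|ij1] := eqVneq i.+1 j.
  subst j; split; last by rewrite -hzS //; exact/hzg/ltnW.
  have -> : hz i.+1 ^ s i = hz i.+1 * hz i * (hz i.+1)^-1.
    rewrite /conjg; apply: (mulgI (s i)); rewrite mulVKg !mulgA.
    apply: (mulIg (hz i.+1)); rewrite mulgVK.
    by rewrite -[RHS]mulgA (hz_commuteM ik) -!mulgA hzSM.
  by apply: genM; [apply: genM; apply: hzg|exact/genV/hzg] => //; exact: ltnW.
have c : commute (hz j) (s i).
  have [lt|ge] := ltnP i j; first by apply: hz_commute_lt => //; lia.
  by apply: hz_commute_gt => //; lia.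
by rewrite (commute_conj c) (commute_conjV c); split; apply: hzg.
Qed.

End Hurwitz.

Lemma homJ (G H : groupType) (f : G -> H) :
  is_hom f -> forall x y, f (x ^ y) = f x ^ f y.
Proof. by move=> fM x y; rewrite /conjg !fM (homV fM). Qed.

Lemma conjg_eq_commute (G : groupType) (x y : G) : x ^ y = x -> commute y x.
Proof. by move=> xy; rewrite /commute [RHS]conjgC xy. Qed.

(** * Faithfulness of the Artin action *)

Section ArtinAction.
Variable n : nat.
Local Notation F := (free 'I_n.+1).

(** Natural-number indices suit the chain lemmas; beyond [n], [inord] falls back to [x_0]. *)
Definition fx i : F := fgen (@inord n i).

Lemma fx_ord (i : 'I_n.+1) : fgen i = fx i.
Proof. by rewrite /fx inord_val. Qed.

Lemma fx_hom_ext (G : groupType) (f g : F -> G) : is_hom f -> is_hom g ->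
  (forall i, (i <= n)%N -> f (fx i) = g (fx i)) -> f =1 g.
Proof.
move=> fM gM fg; apply: free_hom_ext => // i.
by rewrite fx_ord fg // -ltnS.
Qed.

Lemma fx_bij_ext (f g : bij F) : is_hom f -> is_hom g ->
  (forall i, (i <= n)%N -> f (fx i) = g (fx i)) -> f = g.
Proof. by move=> fM gM fg; apply: bij_ext; exact: fx_hom_ext. Qed.

Definition fx_lift (G : groupType) (f : nat -> G) : F -> G :=
  free_lift (fun i : 'I_n.+1 => f i).

Lemma fx_liftM (G : groupType) (f : nat -> G) : is_hom (fx_lift f).
Proof. exact: free_liftM. Qed.

Lemma fx_liftE (G : groupType) (f : nat -> G) i :
  (i <= n)%N -> fx_lift f (fx i) = f i.
Proof. by move=> le; rewrite /fx_lift free_liftE inordK. Qed.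

Definition fkill m : F -> F := fx_lift (fun i => if i == m then 1 else fx i).

Lemma fkillM m : is_hom (fkill m). Proof. exact: fx_liftM. Qed.

Lemma fkillE m i : (i <= n)%N -> fkill m (fx i) = if i == m then 1 else fx i.
Proof. by move=> le; rewrite /fkill fx_liftE. Qed.

(* [x ^ y] is [y^-1 * x * y], so [x_i] is sent to [x_i * x_(i+1) * x_i^-1]. *)
Definition artin_gen i (f : bij F) :=
  [/\ is_hom f, f (fx i) = fx i.+1 ^ (fx i)^-1, f (fx i.+1) = fx i
    & forall j, (j <= n)%N -> j != i -> j != i.+1 -> f (fx j) = fx j].

Section Faithfulness.
Variables (G : groupType) (s : nat -> G) (rho : G -> bij F).
Hypotheses (rhoM : is_hom rho) (sB : braided n s).
Hypothesis rho_s : forall i, (i < n)%N -> artin_gen i (rho (s i)).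

(** [bij F] contains all bijections of [F], so being an automorphism has to be propagated from the
    generators. *)
Lemma rho_gen_hom k x : (k <= n)%N -> gen (s_set k s) x -> is_hom (rho x).
Proof.
move=> kn; elim=> {x} [_ [i ik ->]||x y _ Hx _ Hy|x _ Hx].
- by case: (rho_s (leq_trans ik kn)).
- by rewrite (hom1 rhoM); exact: is_hom1.
- by rewrite rhoM; exact: is_homM.
- by rewrite (homV rhoM); exact: is_homV.
Qed.

(** * Combing off the last strand *)

Section Step.
Variable k : nat.
Hypothesis kn : (k < n)%N.

Local Notation z := (s k * s k).
Local Notation y := (hz k s z).
Local Notation Y := (gen (hz_set k s z)).
Local Notation B := (gen (s_set k s)).
Local Notation top := (fx k.+1).
Local Notation kap := (fkill k.+1).

Let skB : braided k s. Proof. by apply: braidedW sB; exact: ltnW. Qed.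

Lemma square_commute i : (i.+1 < k)%N -> commute z (s i).
Proof.
move=> ik; apply: commute_sym.
by apply: commuteM; apply: sB.2 => //; lia.
Qed.

(** Both sides regroup as the product of the two forms of the braid relation. Thus [s_k^2] starts a
    Hurwitz chain; its members are the pure braids linking the last strand with strand [j]. *)
Lemma square_braid i : i.+1 = k -> s i * z * s i * z = z * s i * z * s i.
Proof.
move=> ik; have := sB.1 i; rewrite ik => /(_ kn) e.
have -> : s i * z * s i * z = (s i * s k * s i) * (s k * s i * s k).
  by rewrite !mulgA; congr (_ * _); rewrite -!mulgA; do 2 congr (_ * _); rewrite !mulgA e.
have -> : z * s i * z * s i = (s k * s i * s k) * (s i * s k * s i).
  rewrite !mulgA; do 2 congr (_ * _).
  by rewrite -!mulgA; congr (_ * _); rewrite !mulgA e.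
by rewrite e.
Qed.

Let Yn := hz_normal skB square_commute square_braid.
Local Notation YB := (gen_mul (hz_set k s z) (s_set k s)).

Lemma gen_hz j : (j <= k)%N -> Y (y j).
Proof. by move=> jk; apply: gen_incl; exists j. Qed.

Lemma gen_s i : (i < k)%N -> B (s i).
Proof. by move=> ik; apply: gen_incl; exists i. Qed.

(* [tr j = s_k * s_(k-1) * ... * s_j], which moves strand [j] to the last place. *)
Definition tr j := (\prod_(j <= i < k.+1) (s i)^-1)^-1.

Lemma tr_top : tr k.+1 = 1.
Proof. by rewrite /tr big_geq // invg1. Qed.

Lemma trS j : (j <= k)%N -> tr j = tr j.+1 * s j.
Proof. by move=> jk; rewrite /tr [in LHS]big_ltn // invgM invgK. Qed.

Lemma tr_commute i j : (i.+1 < j)%N -> commute (s i) (tr j).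
Proof.
move=> ij; apply: commuteV; apply: commute_prod_nat => l /andP[jl lk].
by apply: commuteV; apply: sB.2; lia.
Qed.

Lemma tr_shift i j : (j <= i)%N -> (i < k)%N -> tr j * s i.+1 = s i * tr j.
Proof.
move=> ji ik; elim/down_ind: ji => [|{}j ji IH].
  rewrite (@trS i) ?(@trS i.+1) //; last exact: ltnW.
  rewrite -!mulgA [s i.+1 * (_ * _)]mulgA -sB.1; last by lia.
  by rewrite !mulgA -(tr_commute (ltnSn _)).
rewrite trS; last by lia.
rewrite -mulgA (sB.2 j i.+1) //; last by lia.
by rewrite mulgA IH mulgA.
Qed.

(** Since [s_(j+1) s_j s_(j+1)^-1 = s_j^-1 s_(j+1) s_j], each such element is the next one
    conjugated by [s_j], and [B] normalises [Y]. *)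
Lemma tr_square j : (j <= k)%N -> Y ((s j * s j) ^ (tr j.+1)^-1).
Proof.
move=> jk; elim/down_ind: jk => [|{}j jk IH].
  by rewrite tr_top invg1 conjg1; have := gen_hz (leqnn k); rewrite hzk.
have -> : (s j * s j) ^ (tr j.+1)^-1 = ((s j.+1 * s j.+1) ^ (tr j.+2)^-1) ^ s j.
  rewrite (@trS j.+1) // invgM conjgM.
  have e : s j ^ (s j.+1)^-1 = s j.+1 ^ s j.
    apply: conjV_eq; rewrite /conjg; apply: (mulgI (s j)).
    by rewrite !mulgA mulgV mul1g sB.1 //; lia.
  rewrite conjMg e -conjMg -!conjgM; congr (_ ^ _).
  exact/commuteV/tr_commute.
by apply: Yn IH; exact: gen_s.
Qed.

Definition coset_form w := exists h j, [/\ YB h, (j <= k.+1)%N & w = h * tr j].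

(** If [i] is [j] or [j-1], the representative moves to a neighbour, at the cost of at most an
    element from [tr_square]. Otherwise [s_i] crosses [tr j], becoming [s_(i-1)] when [i > j]. *)
Lemma coset_form_tr i j : (i <= k)%N -> (j <= k.+1)%N ->
  coset_form (tr j * s i) /\ coset_form (tr j * (s i)^-1).
Proof.
move=> ik jk.
have YB1 : YB 1 by apply: gen_mull; exact: gen1.
have q : (s i * s i) ^ (tr i.+1)^-1 * tr i.+1 = tr i * s i.
  by rewrite /conjg invgK (trS ik) !mulgA mulgVK.
have Yq := gen_mull (s_set k s) (tr_square ik).
have [ij|ij] := eqVneq i j.
  subst j; split; first by exists ((s i * s i) ^ (tr i.+1)^-1), i.+1.
  by exists 1, i.+1; split; rewrite // mul1g trS // mulgK.
have [ij1|ij1] := eqVneq i.+1 j.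
  subst j; split; first by exists 1, i; split; rewrite ?mul1g -?trS //; exact: ltnW.
  exists ((s i * s i) ^ (tr i.+1)^-1)^-1, i.
  split; [by apply: (gen_mulV Yn)|exact: ltnW|].
  by apply: (mulIg (s i)); rewrite mulgVK -mulgA -q mulKg.
have [lt|gt] := ltnP i j.
  have c : commute (s i) (tr j) by apply: tr_commute; lia.
  have Bi : B (s i) by apply: gen_s; lia.
  split; [exists (s i), j|exists (s i)^-1, j]; split=> //.
  - exact: gen_mulr.
  - exact/gen_mulr/genV.
  - by apply/commute_sym/commute_sym/commuteV; exact: commute_sym.
case: i ik {q Yq} ij ij1 gt => [|i] ik ij ij1 gt; first by lia.
have e := @tr_shift i j (ltac:(lia)) ik.
split; [exists (s i), j|exists (s i)^-1, j]; split=> //.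
- exact/gen_mulr/gen_s.
- exact/gen_mulr/genV/gen_s.
- by apply: (mulIg (s i.+1)); rewrite mulgVK -mulgA e mulKg.
Qed.

Lemma coset_formP w : gen (s_set k.+1 s) w -> coset_form w.
Proof.
(* The form is shown stable under right multiplication by [w] and [w^-1], which makes the induction
   on [w] work. *)
suff H : gen (s_set k.+1 s) w -> forall v, coset_form v ->
    coset_form (v * w) /\ coset_form (v * w^-1).
  move=> /H /(_ 1) [|]; last by rewrite mul1g.
  exists 1, k.+1; split; rewrite ?tr_top ?mulg1 //.
  by apply: gen_mull; exact: gen1.
have YBl h v : YB h -> coset_form v -> coset_form (h * v).
  move=> YBh [h' [j [YBh' jk ->]]]; exists (h * h'), j; split; rewrite ?mulgA //.
  exact: (gen_mulM Yn).
elim=> {w} [_ [i ik ->]||a b _ Ha _ Hb|a _ Ha] v Qv.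
- case: Qv => h [j [YBh jk ->]]; rewrite -!mulgA.
  by have [] := @coset_form_tr i j ik jk; split; exact: YBl.
- by rewrite invg1 mulg1.
- rewrite invgM !mulgA; split; first exact: (Hb _ (Ha _ Qv).1).1.
  exact: (Ha _ (Hb _ Qv).2).2.
- by rewrite invgK; case: (Ha _ Qv).
Qed.

Lemma rho_Y_hom u : Y u -> is_hom (rho u).
Proof.
move=> Yu; apply: (@rho_gen_hom k.+1) => //.
elim: Yu => {u} [_ [j jk ->]||a b _ Ha _ Hb|a _ Ha].
- have sk i : (i <= k)%N -> gen (s_set k.+1 s) (s i).
    by move=> ik; apply: gen_incl; exists i.
  rewrite hzE /conjg invgK; apply: genM; last apply: genM.
  + by apply: gen_prod => i /andP[_ ik]; apply: sk; exact: ltnW.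
  + by apply: genM; exact: sk.
  + by apply: genV; apply: gen_prod => i /andP[_ ik]; apply: sk; exact: ltnW.
- exact: gen1.
- exact: genM.
- exact: genV.
Qed.

Lemma fkill_B b v : B b -> kap (rho b v) = rho b (kap v).
Proof.
move=> Bb; elim: Bb v => {b} [_ [i ik ->]||a b _ Ha _ Hb|a _ Ha] v.
- have [sM s1 s2 s3] := rho_s (ltn_trans ik kn); have kM := fkillM k.+1.
  move: v; apply: fx_hom_ext => [v w|v w|j jn]; rewrite ?sM ?kM ?sM //.
  have [->|ji] := eqVneq j i.
    by rewrite s1 (homJ kM) (homV kM) !fkillE ?ifN ?s1 //; lia.
  have [->|ji1] := eqVneq j i.+1.
    by rewrite s2 !fkillE ?ifN ?s2 //; lia.
  rewrite s3 // fkillE //; case: ifP => _; first by rewrite (hom1 sM).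
  by rewrite s3.
- by rewrite (hom1 rhoM).
- by rewrite rhoM !bijM Ha Hb.
- by rewrite (homV rhoM) -{2}[v](bijKV (rho a)) Ha bijVK.
Qed.

Lemma rho_B_top b : B b -> rho b top = top.
Proof.
elim=> {b} [_ [i ik ->]||a b _ Ha _ Hb|a _ Ha].
- have [_ _ _ s3] := rho_s (ltn_trans ik kn).
  by apply: s3; lia.
- by rewrite (hom1 rhoM).
- by rewrite rhoM !bijM Hb Ha.
- by rewrite (homV rhoM) -{1}Ha bijVK.
Qed.

(** [s_k^2] only conjugates [x_k] and [top] by words that become trivial for this purpose once [top]
    is killed; the property is then transported along the chain because [B] commutes with [kap]. *)
Lemma fkill_Y u v : Y u -> kap (rho u v) = kap v.
Proof.
move=> Yu; elim: Yu v => {u} [_ [j jk ->]||a b _ Ha _ Hb|a _ Ha] v.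
- elim/down_ind: jk v => [|{}j jk IH] v.
    have [sM s1 s2 s3] := rho_s kn; have kM := fkillM k.+1.
    rewrite hzk rhoM bijM; move: v.
    apply: fx_hom_ext => [v w|v w|i im]; rewrite ?sM ?kM //.
    have [->|ik] := eqVneq i k.
      rewrite s1 (homJ sM) (homV sM) s1 s2 (homJ kM) (homV kM) (homJ kM).
      by rewrite !fkillE ?eqxx ?(ltnW kn) // conj1g invg1 conjg1.
    have [->|ik1] := eqVneq i k.+1.
      by rewrite s2 s1 (homJ kM) !fkillE ?eqxx ?(ltnW kn) // conj1g.
    by rewrite !s3.
  rewrite (hzS _ _ jk) /conjg invgK rhoM rhoM !bijM.
  by rewrite fkill_B ?IH -?fkill_B ?(homV rhoM) ?bijKV //; exact: gen_s.
- by rewrite (hom1 rhoM).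
- by rewrite rhoM bijM Ha Hb.
- by rewrite (homV rhoM) -[in RHS](bijKV (rho a) v) Ha.
Qed.

(** It recovers an element of [Y] from a conjugator. Sending [top] to 1 makes it blind to powers of
    [top], by which the conjugator is ambiguous. *)
Definition htheta := fx_lift (fun j => if (j <= k)%N then (y j)^-1 else 1).

Lemma htheta_fkill v : htheta (kap v) = htheta v.
Proof.
move: v; have tM : is_hom htheta by exact: fx_liftM.
apply: fx_hom_ext => [v w||i im] //; first by rewrite fkillM tM.
rewrite fkillE //; case: eqP => // ->.
by rewrite (hom1 tM) /htheta fx_liftE // ltnn.
Qed.

(* The conjugator [W] recovers [u]: modulo the normal closure of [top], on which
   [htheta] is trivial, the action of [Y] is trivial, so that [W] is multiplicative. *)
Lemma Y_top u : Y u -> exists2 W, rho u top = top ^ W & htheta W = u.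
Proof.
have tM : is_hom htheta by exact: fx_liftM.
elim=> {u} [_ [j jk ->]||a b Ya [W aW Wa] Yb [W' bW Wb]|a Ya [W aW Wa]].
- exists (fx j)^-1; last first.
    by rewrite (homV tM) /htheta fx_liftE ?jk ?invgK //; lia.
  elim/down_ind: jk => [|{}j jk IH].
    have [sM s1 s2 s3] := rho_s kn.
    by rewrite hzk rhoM bijM s2 s1.
  have [sM s1 s2 s3] := rho_s (ltn_trans jk kn).
  rewrite (hzS _ _ jk) /conjg invgK rhoM rhoM !bijM rho_B_top; last exact/genV/gen_s.
  by rewrite IH (homJ sM) (homV sM) s2 rho_B_top //; exact: gen_s.
- by exists 1; rewrite ?(hom1 rhoM) ?conjg1 // (hom1 tM).
- exists (W * rho a W').
    by rewrite rhoM bijM bW (homJ (rho_Y_hom Ya)) aW -conjgM.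
  by rewrite tM -[htheta (rho a _)]htheta_fkill fkill_Y // htheta_fkill Wa Wb.
- have YaV := genV Ya; have aM := rho_Y_hom YaV.
  exists (rho a^-1 W)^-1.
    apply: (conjg_inj (rho a^-1 W)); rewrite -(homJ aM) conjgKV.
    by rewrite -aW (homV rhoM) bijVK.
  by rewrite (homV tM) -htheta_fkill fkill_Y // htheta_fkill Wa.
Qed.

(** [tr j] sends [x_j] to a conjugate of [top]. *)
Lemma fkill_tr j : (j <= k.+1)%N -> kap (rho (tr j) (fx j)) = 1.
Proof.
have kM := fkillM k.+1.
elim/down_ind => [|{}j jk IH].
  by rewrite tr_top (hom1 rhoM) fkillE // eqxx.
have [_ s1 _ _] := rho_s (leq_trans jk kn).
have trM : is_hom (rho (tr j.+1)).
  apply: (@rho_gen_hom k.+1) => //; apply: genV; apply: gen_prod => i /andP[_ ik].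
  by apply: genV; apply: gen_incl; exists i.
by rewrite trS // rhoM bijM s1 (homJ trM) (homJ kM) IH conj1g.
Qed.

Lemma artin_step w : (forall b, B b -> rho b = 1 -> b = 1) ->
  gen (s_set k.+1 s) w -> rho w = 1 -> w = 1.
Proof.
move=> IH /coset_formP[_ [j [[u [b [Yu Bb ->]]] jk ->]]].
rewrite leq_eqVlt in jk; case/predU1P: jk => [->|jk]; last first.
  (* After killing [top], [w] sends [x_j] to 1, while the identity keeps [x_j] for [j <= k]. *)
  move=> w1; have : kap (rho (u * b * tr j) (fx j)) = 1.
    rewrite rhoM rhoM !bijM fkill_Y // fkill_B // fkill_tr; last exact: ltnW.
    by rewrite (hom1 (rho_gen_hom (ltnW kn) Bb)).
  by rewrite w1 bij1 fkillE ?ifN; [|lia..] => /fgen_neq1.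
rewrite tr_top mulg1 => w1.
(* [b] fixes [top]; on the other generators [kap] hides [u] and commutes with [b], so triviality
   passes from [u b] to [b]. *)
have b1 : b = 1.
  apply: IH => //; apply: fx_bij_ext; [exact: rho_gen_hom (ltnW kn) Bb|exact: is_hom1|].
  move=> i im; have [->|ik] := eqVneq i k.+1; first by rewrite rho_B_top.
  have := fkill_Y (rho b (fx i)) Yu; rewrite -bijM -rhoM w1 bij1 fkill_B //.
  by rewrite fkillE // ifN // => <-.
move: w1; rewrite {}b1 mulg1 => u1.
(* [W] centralises [top], hence is a power of it, and [htheta] sends [top] to 1. *)
have [W uW <-] := Y_top Yu; move: uW; rewrite u1 bij1 => /esym/conjg_eq_commute.
have tM : is_hom htheta by exact: fx_liftM.
have ttop : htheta top = 1 by rewrite /htheta fx_liftE // ltnn.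
case/commute_fgen => l [] ->; rewrite ?(homV tM) (homX tM) -/top ttop expg1n //.
by rewrite invg1.
Qed.

End Step.

(** Induction on the number of strands. Only elements satisfying the braid relations are required,
    so this applies directly inside the necklace braid group. *)
Lemma artin_faithful w : gen (s_set n s) w -> rho w = 1 -> w = 1.
Proof.
elim: {1 3}n (leqnn n) w => [|k IH] kn w; last first.
  by apply: artin_step => // b; apply: IH; exact: ltnW.
move=> Sw _; elim: Sw => {w} [_ [//]||a b _ -> _ ->|a _ ->]; rewrite ?mulg1 ?invg1 //.
Qed.

End Faithfulness.
End ArtinAction.

(** * The action of the loop braid group *)

Section LoopAction.
Variable n : nat.
Local Notation F := (free 'I_n.+1).
Local Notation fx := (@fx n).

Definition swap_gen i (f : bij F) :=
  [/\ is_hom f, f (fx i) = fx i.+1, f (fx i.+1) = fx i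
    & forall j, (j <= n)%N -> j != i -> j != i.+1 -> f (fx j) = fx j].

Lemma fx_lift_cancel (f g : nat -> F) :
  (forall i, (i <= n)%N -> fx_lift g (f i) = fx i) ->
  cancel (fx_lift f : F -> F) (fx_lift g).
Proof.
move=> fg; apply: (@fx_hom_ext _ _ (fx_lift g \o fx_lift f) id) => [v w|//|i im] /=.
  by rewrite !fx_liftM.
by rewrite fx_liftE // fg.
Qed.

Lemma fx_bij_exists (f g : nat -> F) :
  (forall i, (i <= n)%N -> fx_lift g (f i) = fx i) ->
  (forall i, (i <= n)%N -> fx_lift f (g i) = fx i) ->
  exists2 h : bij F, is_hom h & forall i, (i <= n)%N -> h (fx i) = f i.
Proof.
move=> fg gf; exists (Bij (fx_lift_cancel fg) (fx_lift_cancel gf)).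
  exact: fx_liftM.
exact: fx_liftE.
Qed.

Lemma artin_exists i : (i < n)%N -> exists f : bij F, artin_gen i f.
Proof.
move=> im; have ne : (i.+1 == i) = false by lia.
have im' := ltnW im.
have [||f fM fE] := @fx_bij_exists
  (fun j => if j == i then fx i.+1 ^ (fx i)^-1 else
            if j == i.+1 then fx i else fx j)
  (fun j => if j == i then fx i.+1 else
            if j == i.+1 then fx i ^ fx i.+1 else fx j).
- move=> j jn; have LM := fx_liftM (n := n).
  case: eqVneq => [->|ji].
    by rewrite (homJ (LM _ _)) (homV (LM _ _)) !fx_liftE // ne !eqxx conjgK.
  case: eqVneq => [->|ji1]; first by rewrite fx_liftE // eqxx.
  by rewrite fx_liftE // !ifN.
- move=> j jn; have LM := fx_liftM (n := n).
  case: eqVneq => [->|ji]; first by rewrite fx_liftE // ne eqxx.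
  case: eqVneq => [->|ji1].
    by rewrite (homJ (LM _ _)) !fx_liftE // ne !eqxx conjgKV.
  by rewrite fx_liftE // !ifN.
exists f; split=> // [||j jn ji ji1]; rewrite fE ?eqxx ?ne //.
by rewrite !ifN.
Qed.

Lemma swap_exists i : (i < n)%N -> exists f, swap_gen i f.
Proof.
move=> im; have ne : (i.+1 == i) = false by lia.
have im' := ltnW im.
pose s j := if j == i then fx i.+1 else if j == i.+1 then fx i else fx j.
have sK j : (j <= n)%N -> fx_lift s (s j) = fx j.
  rewrite {2}/s => jn.
  case: eqVneq => [->|ji]; first by rewrite fx_liftE // /s ne eqxx.
  case: eqVneq => [->|ji1]; first by rewrite fx_liftE // /s eqxx.
  by rewrite fx_liftE // /s !ifN.
have [f fM fE] := fx_bij_exists sK sK.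
exists f; split=> // [||j jn ji ji1]; rewrite fE /s ?eqxx ?ne //.
by rewrite !ifN.
Qed.

(** Relations between automorphisms are verified on each free generator; only generators with
    indices near those of the relation are moved. *)
Ltac gens_facts :=
  repeat match goal with
  | H : artin_gen _ _ |- _ =>
      let M := fresh "M" in case: H => M ? ? ?; have ? := homJ M; have ? := homV M
  | H : swap_gen _ _ |- _ =>
      let M := fresh "M" in case: H => M ? ? ?; have ? := homJ M; have ? := homV M
  end.

Ltac gens_eval :=
  repeat match goal with
  | H : forall x y, bij_fun ?f (x ^ y) = _ |- context [bij_fun ?f (_ ^ _)] => rewrite H
  | H : {morph bij_fun ?f : x / x^-1} |- context [bij_fun ?f (_^-1)] => rewrite H
  | H : bij_fun ?f ?a = _ |- context [bij_fun ?f ?a] => rewrite H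
  | H : forall j, is_true (j <= n)%N -> _ |- context [bij_fun ?f (fx ?j)] =>
      rewrite (H j); [|lia|lia|lia]
  end.

Ltac gens_near i :=
  gens_facts;
  apply: fx_bij_ext; [do ?apply: is_homM => //|do ?apply: is_homM => //|];
  let l := fresh "l" in let ln := fresh "ln" in
  move=> l ln; rewrite !bijM;
  have [?|?] := eqVneq l i; [subst l; gens_eval|
  have [?|?] := eqVneq l i.+1; [subst l; gens_eval|
  have [?|?] := eqVneq l i.+2; [subst l; gens_eval|gens_eval]]].

Lemma near_ggg i (f g : bij F) : (i.+1 < n)%N ->
  artin_gen i f -> artin_gen i.+1 g -> f * g * f = g * f * g.
Proof.
by move=> im Hf Hg; gens_near i; rewrite // /conjg !gnorm.
Qed.

Lemma near_sss i (f g : bij F) : (i.+1 < n)%N ->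
  swap_gen i f -> swap_gen i.+1 g -> f * g * f = g * f * g.
Proof. by move=> im Hf Hg; gens_near i. Qed.

Lemma near_ssg i (f f' g g' : bij F) : (i.+1 < n)%N ->
  swap_gen i f -> swap_gen i.+1 f' -> artin_gen i g -> artin_gen i.+1 g' ->
  f * f' * g = g' * f * f'.
Proof. by move=> im Hf Hf' Hg Hg'; gens_near i. Qed.

Lemma near_ggs i (f f' g g' : bij F) : (i.+1 < n)%N ->
  swap_gen i f -> swap_gen i.+1 f' -> artin_gen i g -> artin_gen i.+1 g' ->
  g * g' * f = f' * g * g'.
Proof. by move=> im Hf Hf' Hg Hg'; gens_near i. Qed.

Ltac gens_far i j :=
  gens_facts;
  apply: fx_bij_ext; [do ?apply: is_homM => //|do ?apply: is_homM => //|];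
  let l := fresh "l" in let ln := fresh "ln" in
  move=> l ln; rewrite !bijM;
  have [?|?] := eqVneq l i; [subst l; gens_eval|
  have [?|?] := eqVneq l i.+1; [subst l; gens_eval|
  have [?|?] := eqVneq l j; [subst l; gens_eval|
  have [?|?] := eqVneq l j.+1; [subst l; gens_eval|gens_eval]]]].

Lemma far_gg i j (f g : bij F) : (i.+1 < j)%N -> (j < n)%N ->
  artin_gen i f -> artin_gen j g -> f * g = g * f.
Proof. by move=> ij jn Hf Hg; gens_far i j. Qed.

Lemma far_ss i j (f g : bij F) : (i.+1 < j)%N -> (j < n)%N ->
  swap_gen i f -> swap_gen j g -> f * g = g * f.
Proof. by move=> ij jn Hf Hg; gens_far i j. Qed.

Lemma far_gs i j (f g : bij F) :
  (i.+1 < j)%N || (j.+1 < i)%N -> (i < n)%N -> (j < n)%N ->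
  artin_gen i f -> swap_gen j g -> f * g = g * f.
Proof. by move=> ij im jm Hf Hg; gens_far i j. Qed.

Lemma swap_gen2 i (f : bij F) : (i < n)%N -> swap_gen i f -> f * f = 1.
Proof.
move=> im Hf; gens_facts; apply: fx_bij_ext; [exact: is_homM|exact: is_hom1|].
move=> l ln; rewrite bijM bij1.
have [?|?] := eqVneq l i; first by subst l; gens_eval.
have [?|?] := eqVneq l i.+1; first by subst l; gens_eval.
by gens_eval.
Qed.

Definition artin_bij (i : 'I_n) : bij F := projT1 (cid (artin_exists (ltn_ord i))).
Definition swap_bij (i : 'I_n) : bij F := projT1 (cid (swap_exists (ltn_ord i))).

Lemma artin_bijP (i : 'I_n) : artin_gen i (artin_bij i).
Proof. exact: (projT2 (cid (artin_exists (ltn_ord i)))). Qed.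

Lemma swap_bijP (i : 'I_n) : swap_gen i (swap_bij i).
Proof. exact: (projT2 (cid (swap_exists (ltn_ord i)))). Qed.

Definition lb_act_gen (a : lb_gen n.+1) : bij F :=
  match a with LBg i => artin_bij i | LBs i => swap_bij i end.

Lemma lb_act_rel x y :
  @lb_rel n.+1 x y -> gexpr_eval lb_act_gen x = gexpr_eval lb_act_gen y.
Proof.
case=> {x y} [i j ji|i j ne1 ne2|i|i j ji|i j ne1 ne2|i j ji|i j ji|i j ij] /=;
  have im := ltn_ord i; try have jn := ltn_ord j;
  have Gi := artin_bijP i; have Si := swap_bijP i;
  try (have Gj := artin_bijP j; have Sj := swap_bijP j); try rewrite ji in Gj Sj jn.
- exact: near_ggg Gi Gj.
- have [ij|ji|/val_inj -> //] := ltngtP i j.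
    by apply: far_gg Gi Gj => //; rewrite ltn_neqAle ij eq_sym andbT; apply/eqP.
  by symmetry; apply: far_gg Gj Gi => //; rewrite ltn_neqAle ji eq_sym andbT; apply/eqP.
- exact: swap_gen2 Si.
- exact: near_sss Si Sj.
- have [ij|ji|/val_inj -> //] := ltngtP i j.
    by apply: far_ss Si Sj => //; rewrite ltn_neqAle ij eq_sym andbT; apply/eqP.
  by symmetry; apply: far_ss Sj Si => //; rewrite ltn_neqAle ji eq_sym andbT; apply/eqP.
- exact: near_ssg Si Sj Gi Gj.
- exact: near_ggs Si Sj Gi Gj.
- exact: far_gs Gi Sj.
Qed.

Definition lb_act : LB n.+1 -> bij F := @pres_lift _ (@lb_rel n.+1) _ lb_act_gen.

Lemma lb_actM : is_hom lb_act. Proof. exact: pres_liftM lb_act_rel. Qed.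

Lemma lb_act_g (i : 'I_n) : artin_gen i (lb_act (@gLB n.+1 i)).
Proof. by rewrite /lb_act (pres_liftE lb_act_rel); exact: artin_bijP. Qed.

Lemma lb_act_s (i : 'I_n) : swap_gen i (lb_act (@sLB n.+1 i)).
Proof. by rewrite /lb_act (pres_liftE lb_act_rel); exact: swap_bijP. Qed.

End LoopAction.

(** * The homomorphism from the necklace to the loop braid group *)

Section PresentedFacts.
Variables (X : Type) (R : gexpr X -> gexpr X -> Prop).

Lemma gexpr_eval_class e : gexpr_eval (pres_gen R) e = pres_class R e.
Proof.
elim: e => [a||a IHa b IHb|a IHa] //=.
- by rewrite IHa IHb [LHS]pres_opE.
- by rewrite IHa [LHS]pres_oppE.
Qed.

Lemma pres_relE x y :
  R x y -> gexpr_eval (pres_gen R) x = gexpr_eval (pres_gen R) y.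
Proof. by move=> Rxy; rewrite !gexpr_eval_class; apply/pres_classP/pres_rel. Qed.

End PresentedFacts.

Section LoopBraid.
Variable n : nat.

(** There are [n+1] circles here, hence [n] generators of each kind; natural-number indices allow
    the use of [braided]. *)
Definition lb_g i : LB n.+1 := if insub i is Some j then @gLB n.+1 j else 1.
Definition lb_s i : LB n.+1 := if insub i is Some j then @sLB n.+1 j else 1.
Local Notation p := (pLB n.+1).

Lemma lb_gE i (im : (i < n)%N) : lb_g i = @gLB n.+1 (Ordinal im).
Proof. by rewrite /lb_g insubT. Qed.

Lemma lb_sE i (im : (i < n)%N) : lb_s i = @sLB n.+1 (Ordinal im).
Proof. by rewrite /lb_s insubT. Qed.

Lemma pLBE : p = \prod_(0 <= i < n) lb_s i.
Proof. by rewrite big_mkord; apply: eq_bigr => -[i im] _; rewrite lb_sE. Qed.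

Lemma lb_s_braided : braided n lb_s.
Proof.
split=> [i im|i j ij jm].
  have im' := ltnW im.
  rewrite (lb_sE im) (lb_sE im').
  exact: (pres_relE (@LB_ss n.+1 (Ordinal im') (Ordinal im) erefl)).
have im : (i < n)%N by lia.
rewrite (lb_sE im) (lb_sE jm).
by apply: (pres_relE (@LB_ssC n.+1 (Ordinal im) (Ordinal jm) _ _)) => /=; lia.
Qed.

Lemma lb_g_braided : braided n lb_g.
Proof.
split=> [i im|i j ij jm].
  have im' := ltnW im.
  rewrite (lb_gE im) (lb_gE im').
  exact: (pres_relE (@LB_gg n.+1 (Ordinal im') (Ordinal im) erefl)).
have im : (i < n)%N by lia.
rewrite (lb_gE im) (lb_gE jm).
by apply: (pres_relE (@LB_ggC n.+1 (Ordinal im) (Ordinal jm) _ _)) => /=; lia.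
Qed.

Lemma lb_s2 i : (i < n)%N -> lb_s i * lb_s i = 1.
Proof.
move=> im; rewrite (lb_sE im).
exact: (pres_relE (@LB_s2 n.+1 (Ordinal im))).
Qed.

Lemma lb_gs_commute i j : (i < n)%N -> (j < n)%N ->
  (i.+1 < j)%N || (j.+1 < i)%N -> commute (lb_g i) (lb_s j).
Proof.
move=> im jm ij; rewrite (lb_gE im) (lb_sE jm).
exact: (pres_relE (@LB_gsC n.+1 (Ordinal im) (Ordinal jm) ij)).
Qed.

Lemma lb_ssg i : (i.+1 < n)%N ->
  lb_s i * lb_s i.+1 * lb_g i = lb_g i.+1 * lb_s i * lb_s i.+1.
Proof.
move=> im; have im' := ltnW im.
rewrite (lb_sE im) (lb_sE im') (lb_gE im) (lb_gE im').
exact: (pres_relE (@LB_ssg n.+1 (Ordinal im') (Ordinal im) erefl)).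
Qed.

Lemma pLBX : p ^+ n.+1 = 1.
Proof. by rewrite pLBE; exact: coxeter_power lb_s_braided lb_s2. Qed.

Lemma pLB_shift i : (i.+1 < n)%N -> p * lb_g i = lb_g i.+1 * p.
Proof. by rewrite pLBE; exact: shift_prod lb_gs_commute lb_ssg i. Qed.

(* For [i < n] this is [g_i], and for [i = n] it is [p * g_(n-1) * p^-1]; it is
   periodic in [i] because [p ^+ n.+1 = 1]. *)
Definition lb_cyc i := lb_g 0 ^ (p ^- i).

Lemma lb_cycS i : lb_cyc i.+1 = lb_cyc i ^ p^-1.
Proof. by rewrite /lb_cyc -conjgM -invgM expgS. Qed.

Lemma lb_cycD i j : lb_cyc (i + j) = lb_cyc j ^ (p ^- i).
Proof. by rewrite /lb_cyc -conjgM -invgM expgnDr. Qed.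

Lemma lb_cyc_mod i : lb_cyc (i %% n.+1) = lb_cyc i.
Proof.
rewrite [in RHS](divn_eq i n.+1) lb_cycD mulnC expgnA pLBX expg1n invg1.
by rewrite conjg1.
Qed.

Lemma lb_cycE i : (i < n)%N -> lb_cyc i = lb_g i.
Proof.
elim: i => [|i IH] im; first by rewrite /lb_cyc expg0 invg1 conjg1.
by rewrite lb_cycS IH ?(ltnW im) //; apply: conjV_eq; exact: pLB_shift.
Qed.

(** Conjugation by [p^i] carries the braid relation of [g_0] and [g_1] to every cyclic position. *)
Lemma lb_cyc_braid i : (1 < n)%N ->
  lb_cyc i * lb_cyc i.+1 * lb_cyc i = lb_cyc i.+1 * lb_cyc i * lb_cyc i.+1.
Proof.
move=> n1; have e j : lb_cyc (i + j) = lb_cyc j ^ (p ^- i) := lb_cycD i j.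
have := e 0%N; have := e 1%N; rewrite addn0 addn1 => -> ->; rewrite -!conjMg.
rewrite !lb_cycE //; last exact: ltnW.
by rewrite lb_g_braided.1.
Qed.

(** This is the commutation of [g_0] with [g_(j-i)], conjugated by [p^i]. *)
Lemma lb_cyc_commute i j : (i.+1 < j)%N -> (j <= n)%N -> (j < i + n)%N ->
  commute (lb_cyc i) (lb_cyc j).
Proof.
move=> ij jn jin; rewrite -[j](subnKC (ltnW (ltnW ij))) -[X in lb_cyc X]addn0 !lb_cycD.
apply: commuteJ; rewrite !lb_cycE; [|lia..].
by apply: lb_g_braided.2; lia.
Qed.

Definition zeta_gen (a : nb_gen n.+1) : LB n.+1 :=
  match a with NBsigma i => lb_cyc i | NBtau => p end.

Lemma zeta_rel x y : (1 < n)%N ->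
  @nb_rel n.+1 x y -> gexpr_eval zeta_gen x = gexpr_eval zeta_gen y.
Proof.
move=> n1; case=> {x y} [i|i j ij ji|i|].
- by rewrite /= lb_cyc_mod lb_cyc_braid.
- have far (k l : 'I_n.+1) : l <> ordS k -> k <> ordS l -> (k < l)%N ->
      commute (lb_cyc k) (lb_cyc l).
    move=> lk kl ltkl; have kn := ltn_ord k; have ln := ltn_ord l.
    have kl1 : k.+1 != l.
      by apply/eqP => e; apply: lk; apply: val_inj; rewrite /= modn_small e.
    apply: lb_cyc_commute; [by rewrite ltn_neqAle kl1|by []|].
    (* The bound [l < k + n] could only fail for [k = 0], [l = n], which are cyclic neighbours. *)
    have [k0|k0] := eqVneq (k : nat) 0%N; last by lia.
    rewrite k0 add0n ltn_neqAle -ltnS ln andbT; apply/eqP => e.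
    by apply: kl; apply: val_inj; rewrite /= e modnn k0.
  rewrite /=; have [ltij|ltji|/val_inj -> //] := ltngtP i j; first exact: far.
  by symmetry; apply: far.
- by rewrite /= lb_cyc_mod lb_cycS [RHS]/conjg invgK [RHS]mulgA.
- by rewrite gexpr_evalX /= mulnC expgnA pLBX expg1n.
Qed.

Lemma zeta_exists : (1 < n)%N ->
  exists zeta : {multiplicative NB n.+1 -> LB n.+1}, is_zeta zeta.
Proof.
move=> n1; have R x y := @zeta_rel x y n1.
pose h : NB n.+1 -> LB n.+1 := @pres_lift _ (@nb_rel n.+1) _ zeta_gen.
pose hm := isMultiplicative.Build _ _ h (pres_liftM R).
pose zeta : {multiplicative NB n.+1 -> LB n.+1} := HB.pack h hm.
have hE a : h (pres_gen _ a) = zeta_gen a by exact: (pres_liftE R).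
exists zeta; split=> [|i j ij|i j iE jE]; rewrite /= hE //=.
  by case: j ij => j jn /= ->; rewrite lb_cycE ?(lb_gE jn).
have -> : (i : nat) = (j : nat).+1 by rewrite iE jE /=; lia.
by case: j {iE jE} => j jn /=; rewrite lb_cycS lb_cycE ?(lb_gE jn) // /conjg invgK mulgA.
Qed.

End LoopBraid.

(** * The kernel *)

Section Delta.
Variable n : nat.
Local Notation F := (free 'I_n.+1).
Local Notation fx := (@fx n).

Definition fdelta : F := \prod_(0 <= i < n.+1) fx i.

Lemma artin_gen_fdelta i (f : bij F) :
  (i < n)%N -> artin_gen i f -> f fdelta = fdelta.
Proof.
move=> im [fM f1 f2 f3].
have fixed a b : (b <= n.+1)%N -> (b <= i)%N || (i.+1 < a)%N ->
    f (\prod_(a <= j < b) fx j) = \prod_(a <= j < b) fx j.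
  move=> bn abi; rewrite (hom_prod fM); apply: eq_big_nat => j /andP[aj jb].
  by apply: f3; lia.
have dE : fdelta =
    (\prod_(0 <= j < i) fx j) * (fx i * fx i.+1) * \prod_(i.+2 <= j < n.+1) fx j.
  rewrite /fdelta (@prod_nat_split _ 0 i n.+1); last by lia.
  by rewrite (@big_ltn _ _ _ i) ?(@big_ltn _ _ _ i.+1) ?mulgA //; lia.
rewrite dE !fM !fixed ?leqnn ?orbT //; last by lia.
by rewrite f1 f2 /conjg invgK -!mulgA mulKg.
Qed.

(* [x_0 |-> x_0 ... x_n] extends to an automorphism fixing the other
   generators, so this reduces to the centralizer of a generator. *)
Lemma commute_fdelta w : commute w fdelta -> cyclic_subgroup fdelta w.
Proof.
pose r := \prod_(1 <= i < n.+1) fx i.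
have dE : fdelta = fx 0%N * r by rewrite /fdelta big_ltn.
pose phi : F -> F := fx_lift (fun i => if i == 0%N then fx 0%N * r^-1 else fx i).
pose psi : F -> F := fx_lift (fun i => if i == 0%N then fdelta else fx i).
have phiM : is_hom phi := fx_liftM _; have psiM : is_hom psi := fx_liftM _.
have phi_r : phi r = r.
  rewrite (hom_prod phiM); apply: eq_big_nat => i /andP[i0 im].
  by rewrite /phi fx_liftE // ifN //; lia.
have psi_r : psi r = r.
  rewrite (hom_prod psiM); apply: eq_big_nat => i /andP[i0 im].
  by rewrite /psi fx_liftE // ifN //; lia.
have psi0 : psi (fx 0%N) = fdelta by rewrite /psi fx_liftE.
have phiK : cancel phi psi.
  apply: (@fx_hom_ext _ _ (psi \o phi) id) => [u v|//|i im] /=.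
    by rewrite phiM psiM.
  rewrite {1}/phi fx_liftE //; case: eqP => [->|/eqP i0].
    by rewrite psiM (homV psiM) psi_r psi0 dE mulgK.
  by rewrite /psi fx_liftE // ifN.
have phi_d : phi fdelta = fx 0%N by rewrite dE phiM phi_r /phi fx_liftE //= mulgVK.
move=> wd; have : commute (phi w) (fx 0%N).
  by rewrite -phi_d /commute -!phiM wd.
case/commute_fgen => k e; exists k.
case: e => /(congr1 psi); rewrite phiK ?(homV psiM) (homX psiM) psi0.
- by left.
- by right.
Qed.

End Delta.

(** * The Hurwitz chain in the necklace braid group *)

Section Necklace.
Variable n : nat.
Hypothesis n_gt1 : (1 < n)%N.
Local Notation NBn := (NB n.+1).
Local Notation t := (tau n.+1).

Definition nb_s i : NBn := sigma (inord (i %% n.+1)).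

Lemma sigmaE (i : 'I_n.+1) : sigma i = nb_s i.
Proof. by rewrite /nb_s modn_small // inord_val. Qed.

Lemma nb_sD i : nb_s (i + n.+1) = nb_s i.
Proof. by rewrite /nb_s modnDr. Qed.

Lemma ordS_inord i : ordS (inord (i %% n.+1)) = inord (i.+1 %% n.+1) :> 'I_n.+1.
Proof.
apply: val_inj; rewrite /= !inordK ?ltn_mod //.
by rewrite -addn1 modnDml addn1.
Qed.

Lemma nb_shift i : t * nb_s i = nb_s i.+1 * t.
Proof.
have e : t * nb_s i * t^-1 = nb_s i.+1.
  by rewrite [in RHS]/nb_s -ordS_inord; exact: (pres_relE (NB_N1 _)).
by rewrite -e mulgVK.
Qed.

Lemma nb_shiftX k i : t ^+ k * nb_s i = nb_s (i + k) * t ^+ k.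
Proof.
elim: k i => [|k IH] i; first by rewrite addn0 expg0 mul1g mulg1.
by rewrite expgS -mulgA IH mulgA nb_shift -mulgA addnS.
Qed.

Lemma nb_braid i : nb_s i * nb_s i.+1 * nb_s i = nb_s i.+1 * nb_s i * nb_s i.+1.
Proof. by rewrite /nb_s -ordS_inord; exact: (pres_relE (NB_B1 _)). Qed.

Lemma nb_braided : braided n nb_s.
Proof.
split=> [i _|i j ij jn]; first exact: nb_braid.
have im : (i < n)%N by lia.
have e k : (k <= n)%N -> nat_of_ord (inord (k %% n.+1) : 'I_n.+1) = k.
  by move=> kn; rewrite modn_small // inordK.
by apply: (pres_relE (NB_B2 _ _)); rewrite ordS_inord => /(congr1 val) /=;
  rewrite !e; lia.
Qed.

Lemma tau_central x : commute (t ^+ n.+1) x.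
Proof.
apply: gen_commute (gen_presented x) => _ [[i|] _ <-].
  rewrite -/(sigma i) sigmaE.
  by rewrite /commute nb_shiftX nb_sD.
exact/commute_sym/commuteX/commute_refl.
Qed.

Local Notation A := (\prod_(0 <= i < n) nb_s i).
Local Notation A' := (\prod_(0 <= i < n.-1) nb_s i).
Local Notation A'' := (\prod_(1 <= i < n) nb_s i).
Local Notation s := (nb_s n.-1).
Local Notation z := (A^-1 * t).

Let n_gt0 : (0 < n)%N. Proof. exact: ltnW. Qed.

Lemma A_recr : A = A' * s.
Proof.
rewrite (@prod_nat_split _ 0 n.-1 n) ?leq_pred //; congr (_ * _).
by rewrite big_ltn ?big_geq ?mulg1 //; lia.
Qed.

Lemma A_recl : A = nb_s 0 * A''.
Proof. by rewrite big_ltn. Qed.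

Lemma tau_A' : t * A' = A'' * t.
Proof.
have e k : t * \prod_(0 <= i < k) nb_s i = (\prod_(1 <= i < k.+1) nb_s i) * t.
  elim: k => [|k IH]; first by rewrite !big_geq // mul1g mulg1.
  by rewrite big_nat_recr // [in RHS]big_nat_recr //= mulgA IH -!mulgA nb_shift.
by rewrite e prednK.
Qed.

Lemma sV_z : s * z = A'^-1 * t.
Proof. by rewrite A_recr invgM !mulgA mulgV mul1g. Qed.

Lemma tau_s : t * s = nb_s n * t.
Proof. by rewrite nb_shift prednK. Qed.

Lemma tau2_s : t * t * s = nb_s 0 * (t * t).
Proof. by rewrite -expg2 nb_shiftX -[in RHS]nb_sD add0n addn2 prednK. Qed.

(** Conjugation by [A] and by [tau] shifts [sigma_i] in the same way, so [A^-1 tau] commutes with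
    it. *)
Lemma z_commute i : (i.+1 < n)%N -> commute z (nb_s i).
Proof.
move=> im; rewrite /commute -mulgA nb_shift !mulgA; congr (_ * _).
apply: (mulgI A); rewrite !mulgA mulgV mul1g (braided_shift nb_braided) //.
by rewrite mulgK.
Qed.

Lemma tau_A'V : t * A'^-1 = A''^-1 * t.
Proof. by apply: (mulgI A''); rewrite mulVKg mulgA -tau_A' mulgK. Qed.

(** The relation says that [s] commutes with [(s z)^2 = A'^-1 A''^-1 tau^2]. As [tau^2] takes [s] to
    [sigma_0], this reduces to the shift identity [A A' = A'' A]. *)
Lemma z_braid i : i.+1 = n -> nb_s i * z * nb_s i * z = z * nb_s i * z * nb_s i.
Proof.
move=> ni; have {ni} -> : i = n.-1 by rewrite -ni.
rewrite -[LHS]mulgA sV_z; apply: (mulgI s).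
have -> : s * (z * s * z * s) = s * z * s * z * s by rewrite !mulgA.
rewrite sV_z.
have -> : A'^-1 * t * s * z = A'^-1 * A''^-1 * (t * t).
  by rewrite -[_ * s * z]mulgA sV_z -mulgA [t * (_ * _)]mulgA tau_A'V !mulgA.
have -> : A'^-1 * t * (A'^-1 * t) = A'^-1 * A''^-1 * (t * t).
  by rewrite -mulgA [t * (_ * _)]mulgA tau_A'V !mulgA.
rewrite -[RHS]mulgA tau2_s !mulgA; do 2 congr (_ * _).
have e := braided_shift_prod nb_braided 0 (ltac:(lia) : (n.-1 < n)%N).
rewrite prednK // in e.
have m : A'' * A' * s = nb_s 0 * (A'' * A').
  by rewrite -mulgA -A_recr -e A_recl !mulgA.
rewrite -mulgA -!invgM; apply: (mulgI (A'' * A')).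
by rewrite mulVKg mulgA m mulgK.
Qed.

Local Notation y := (hz n nb_s z).
Let yn := hz_normal nb_braided z_commute z_braid.
Local Notation YB := (gen_mul (hz_set n nb_s z) (s_set n nb_s)).

Lemma y0E : y 0%N = t * A^-1.
Proof. by rewrite hzE /conjg invgK !mulgA mulgV mul1g. Qed.

Lemma gen_s_A : gen (s_set n nb_s) A.
Proof. by apply: gen_prod => i /andP[_ im]; apply: gen_incl; exists i. Qed.

(** The remaining generators are [tau = y_0 A] and [sigma_n = tau sigma_(n-1) tau^-1]. *)
Lemma nb_decomposition x : YB x.
Proof.
have YBs i : (i < n)%N -> YB (nb_s i).
  by move=> im; apply/gen_mulr/gen_incl; exists i.
have YBt : YB t.
  have e : y 0%N * A = t by rewrite y0E mulgVK.
  rewrite -[X in gen_mul _ _ X]e; apply: (gen_mulM yn); last exact/gen_mulr/gen_s_A.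
  by apply/gen_mull/gen_incl; exists 0%N.
elim: (gen_presented x) => {x} [_ [[i|] _ <-]||a b _ Ha _ Hb|a _ Ha].
- rewrite -/(sigma i) sigmaE.
  have := ltn_ord i; rewrite ltnS leq_eqVlt => /predU1P[->|]; last exact: YBs.
  have -> : nb_s n = t * s * t^-1 by rewrite tau_s mulgK.
  by do ![exact: (gen_mulV yn)|apply: (gen_mulM yn)|apply: YBs] => //; rewrite prednK.
- exact: YBt.
- by apply: gen_mull; exact: gen1.
- exact: (gen_mulM yn).
- exact: (gen_mulV yn).
Qed.

(** [tau] shifts the recursion defining the chain, so only its end, [j = n-1], needs a
    computation. *)
Lemma tau_y j : (j < n)%N -> y j ^ t^-1 = y j.+1.
Proof.
move=> jn; have jn' : (j <= n.-1)%N by lia.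
elim/down_ind: jn' {jn} => [|{}j jn IH].
  rewrite hzS ?prednK // hzk; apply: conjV_eq.
  apply: (mulIg s); rewrite /conjg invgK !mulgA mulgVK.
  rewrite -[t * s * _ * t]mulgA -[t * s * _]mulgA [s * _]mulgA.
  rewrite -[s * _ * t]mulgA sV_z mulgA tau_A'V.
  rewrite -!mulgA [t * (t * s)]mulgA tau2_s A_recl invgM !mulgA.
  by rewrite mulgVK.
rewrite (hzS _ _ (ltac:(lia) : (j < n)%N)) conjJg IH.
rewrite (hzS _ _ (ltac:(lia) : (j.+1 < n)%N)); congr (_ ^ _).
by rewrite conjVg; congr _^-1; apply: conjV_eq; exact: nb_shift.
Qed.

Lemma y_tauX j : (j <= n)%N -> y j = y 0%N ^ (t ^- j).
Proof.
elim: j => [|j IH] jn; first by rewrite expg0 invg1 conjg1.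
by rewrite -tau_y // IH ?(ltnW jn) // -conjgM -invgM expgS.
Qed.

Definition ytheta : free 'I_n.+1 -> NBn := fx_lift (fun j => (y j)^-1).

Lemma ythetaM : is_hom ytheta. Proof. exact: fx_liftM. Qed.

Lemma ytheta_fdelta : ytheta (fdelta n) = A ^+ n.+1 * t ^- n.+1.
Proof.
(* The product telescopes: [y_j = tau^j y_0 tau^-j] and [y_0^-1 tau = A]. *)
suff e k : (k <= n.+1)%N -> A ^+ k = (\prod_(0 <= j < k) (y j)^-1) * t ^+ k.
  rewrite e // mulgK (hom_prod ythetaM); apply: eq_big_nat => j /andP[_ jn].
  by rewrite /ytheta fx_liftE.
elim: k => [|k IH] kn; first by rewrite (@big_geq _ _ _ 0 0) // !expg0 mulg1.
rewrite expgSr IH ?(ltnW kn) // (@big_nat_recr _ _ _ k) //= -!mulgA; congr (_ * _).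
have e : (y 0%N)^-1 * t = A by rewrite y0E invgM invgK mulgVK.
by rewrite y_tauX // -conjVg /conjg invgK expgSr -!mulgA mulKg e.
Qed.

(** * The action through [zeta] and the kernel *)

Section Kernel.
Variable zeta : {multiplicative NBn -> LB n.+1}.
Hypothesis zetaP : is_zeta zeta.
Local Notation fx := (@fx n).

Let zetaM : is_hom zeta. Proof. exact: gmulfM. Qed.

Definition nb_act (x : NBn) := lb_act (zeta x).
Local Notation rho := nb_act.

Lemma nb_actM : is_hom rho.
Proof. by move=> u v; rewrite /rho zetaM lb_actM. Qed.

Lemma nb_act_s i : (i < n)%N -> artin_gen i (rho (nb_s i)).
Proof.
case: zetaP => _ zs _ im; rewrite /rho /nb_s.
rewrite (zs _ (Ordinal im : 'I_n.+1.-1)); first exact: lb_act_g (Ordinal im).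
by rewrite inordK ?ltn_mod // modn_small // ltnS ltnW.
Qed.

Lemma zeta_tauX : zeta (t ^+ n.+1) = 1.
Proof. by rewrite (homX zetaM); case: zetaP => -> _ _; exact: pLBX. Qed.

Lemma nb_act_tau_hom : is_hom (rho t).
Proof.
rewrite /rho; case: zetaP => -> _ _; rewrite pLBE (hom_prod (@lb_actM n)).
rewrite big_nat_cond.
apply: (big_ind (fun f : bij _ => is_hom f)) => [|f g|i].
- exact: is_hom1.
- exact: is_homM.
- by rewrite andbT => im; rewrite (lb_sE im); case: (lb_act_s (Ordinal im)).
Qed.

Lemma nb_act_tau :
  (forall j, (j < n)%N -> rho t (fx j) = fx j.+1) /\ rho t (fx n) = fx 0%N.
Proof.
rewrite /rho; case: zetaP => -> _ _; rewrite pLBE.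
have H k : (k <= n)%N -> let f := lb_act (\prod_(0 <= i < k) lb_s n i) in
    [/\ forall j, (j < k)%N -> f (fx j) = fx j.+1, f (fx k) = fx 0%N
      & forall j, (k < j <= n)%N -> f (fx j) = fx j].
  elim: k => [|k IH] kn /=; first by rewrite big_geq // (hom1 (@lb_actM n)).
  have [p1 p2 p3] := IH (ltnW kn).
  rewrite big_nat_recr //= lb_actM (lb_sE kn).
  have [_ s1 s2 s3] := lb_act_s (Ordinal kn); rewrite /= in s1 s2 s3.
  split=> [j|| j /andP[kj jn]]; rewrite !bijM.
  - rewrite ltnS leq_eqVlt => /predU1P[->|jk]; first by rewrite s1 p3 ?leqnn.
    by rewrite s3 ?p1 //; lia.
  - by rewrite s2 p2.
  - by rewrite s3 ?p3 //; lia.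
by have [] := H n (leqnn n).
Qed.

(** [A] acts as the cyclic permutation given by [tau] up to an inner automorphism, which is why
    [z = A^-1 tau] acts by conjugation. *)
Lemma nb_act_A v : rho A v = (rho t v) ^ (fx 0%N)^-1.
Proof.
have rA (k : nat) : (k <= n)%N ->
    let f := rho (\prod_(0 <= i < k) nb_s i) in
    [/\ is_hom f, forall j, (j < k)%N -> f (fx j) = fx j.+1 ^ (fx 0%N)^-1,
        f (fx k) = fx 0%N & forall j, (k < j <= n)%N -> f (fx j) = fx j].
  elim: k => [|k IH] kn /=; first by rewrite big_geq // (hom1 nb_actM).
  have [fM p1 p2 p3] := IH (ltnW kn).
  rewrite big_nat_recr //= nb_actM.
  have [sM s1 s2 s3] := nb_act_s kn.
  split=> [|j|| j /andP[kj jn]]; rewrite ?bijM.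
  - exact: is_homM.
  - rewrite ltnS leq_eqVlt => /predU1P[->|jk].
      by rewrite s1 (homJ fM) (homV fM) p2 p3 ?leqnn.
    by rewrite s3 ?p1 //; lia.
  - by rewrite s2 p2.
  - by rewrite s3 ?p3 //; lia.
have [fM p1 p2 _] := rA n (leqnn n); have [t1 t2] := nb_act_tau.
apply: (@fx_hom_ext _ _ (rho A) (fun w => rho t w ^ (fx 0%N)^-1)) v => //.
  by move=> u w; rewrite nb_act_tau_hom conjMg.
move=> j; rewrite leq_eqVlt => /predU1P[->|jn]; last by rewrite p1 // t1.
by rewrite p2 t2 /conjg invgK mulgV mulg1.
Qed.

(** For [z] this follows from [nb_act_A]; conjugating by [sigma_j] replaces the conjugator [x_(j+1)]
    by its image [x_j]. *)
Lemma nb_act_y j v : (j <= n)%N -> rho (y j) v = v ^ fx j.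
Proof.
move=> jn; elim/down_ind: jn v => [|{}j jn IH] v.
  rewrite hzk nb_actM (homV nb_actM) bijM.
  have [_ t2] := nb_act_tau.
  have -> : rho t v = rho A (v ^ fx n).
    by rewrite nb_act_A (homJ nb_act_tau_hom) t2 conjgK.
  by rewrite bijVK.
have [sM s1 s2 s3] := nb_act_s jn.
rewrite hzS // /conjg invgK !nb_actM !bijM IH (homJ sM) s2.
by rewrite (homV nb_actM) bijKV.
Qed.

Lemma Y_inner u : gen (hz_set n nb_s z) u ->
  exists2 w, ytheta w = u & forall v, rho u v = v ^ w^-1.
Proof.
elim=> {u} [_ [j jn ->]||a b _ [w <- wE] _ [w' <- wE']|a _ [w <- wE]].
- exists (fx j)^-1 => [|v]; last by rewrite invgK nb_act_y.
  by rewrite (homV ythetaM) /ytheta fx_liftE ?invgK.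
- by exists 1 => [|v]; rewrite ?(hom1 ythetaM) // (hom1 nb_actM) invg1 conjg1.
- exists (w * w') => [|v]; first by rewrite ythetaM.
  by rewrite nb_actM bijM wE' wE invgM conjgM.
- exists w^-1 => [|v]; first by rewrite (homV ythetaM).
  by rewrite (homV nb_actM) -{2}[v](bijKV (rho (ytheta w))) wE invgK conjgKV.
Qed.

Lemma nb_act_B_fdelta b : gen (s_set n nb_s) b -> rho b (fdelta n) = fdelta n.
Proof.
elim=> {b} [_ [i im ->]||a b _ Ha _ Hb|a _ Ha].
- exact: artin_gen_fdelta (nb_act_s im).
- by rewrite (hom1 nb_actM).
- by rewrite nb_actM bijM Hb Ha.
- by rewrite (homV nb_actM) -{1}Ha bijVK.
Qed.

Lemma zeta_ker x : zeta x = 1 -> cyclic_subgroup (t ^+ n.+1) x.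
Proof.
move=> x1; have : rho x = 1 by rewrite /rho x1 (hom1 (@lb_actM n)).
set c := t ^+ n.+1 => {x1}.
have rc : rho c = 1 by rewrite /rho zeta_tauX (hom1 (@lb_actM n)).
have [u [b [/Y_inner[w <- wE] Bb ->]]] := nb_decomposition x.
rewrite nb_actM => ub.
(* [b] fixes [delta] and [u b] acts trivially, so conjugation by [w^-1] fixes [delta]. *)
have : commute w (fdelta n).
  apply: conjg_eq_commute; rewrite -[in RHS](nb_act_B_fdelta Bb).
  apply: (conjg_inj w^-1); rewrite conjgK -wE -bijM ub bij1.
  by [].
(* Here [u = a d] with [a] in [B] and [d] a power of [c]; then [a b] lies in [B] and acts trivially,
   so Artin's theorem leaves only [d]. *)
have key a d : gen (s_set n nb_s) a -> (forall v, commute d v) -> rho d = 1 ->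
    rho (a * d) * rho b = 1 -> a * d * b = d.
  move=> Ba dC rd; rewrite -(dC a) nb_actM rd mul1g -nb_actM => ab.
  suff e : a * b = 1 by rewrite -mulgA e mulg1.
  by apply: (artin_faithful nb_actM nb_braided nb_act_s) => //; exact: genM.
have cC v : commute c v by exact: tau_central.
have cXC k v : commute (c ^+ k) v by apply/commute_sym/commuteX/commute_sym.
have powE k : (A ^+ n.+1 * c^-1) ^+ k = A ^+ n.+1 ^+ k * c ^- k.
  by rewrite expgMn ?expVgn //; exact/commuteV/commute_sym.
case/commute_fdelta => k [] wk; rewrite {}wk ?(homV ythetaM) (homX ythetaM)
  ytheta_fdelta powE in ub *.
  exists k; right; apply: key ub; first exact/genX/genX/gen_s_A.
    by move=> v; apply/commute_sym/commuteV/commute_sym.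
  by rewrite (homV nb_actM) (homX nb_actM) rc expg1n invg1.
have e : (A ^+ n.+1 ^+ k * c ^- k)^-1 = A ^+ n.+1 ^- k * c ^+ k.
  by rewrite invgM invgK; exact: cXC.
exists k; left; rewrite e in ub *; apply: key ub.
- exact/genV/genX/genX/gen_s_A.
- by [].
- by rewrite (homX nb_actM) rc expg1n.
Qed.

Lemma zeta_kerE : ker zeta = cyclic_subgroup (t ^+ n.+1).
Proof.
apply/seteqP; split=> [x|x [k]]; first exact: zeta_ker.
have ck : zeta (t ^+ n.+1 ^+ k) = 1 by rewrite (homX zetaM) zeta_tauX expg1n.
by case=> ->; rewrite /ker /= ?(homV zetaM) ck ?invg1.
Qed.

End Kernel.

Lemma tauX_neq1 : t ^+ n.+1 <> 1.
Proof.
pose m := (n + n.+1)%N.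
(* Counting [tau] modulo [2(n+1) = m+1]: in this cyclic group [1] is the neutral element, the
   residue 0, and [Zp1] is the residue one. *)
pose f (a : nb_gen n.+1) : 'I_m.+1 := if a is NBtau then Zp1 else 1.
have fR x y : @nb_rel n.+1 x y -> gexpr_eval f x = gexpr_eval f y.
  case=> {x y} [i|i j _ _|i|] //=; first by rewrite mulg1 mulgV.
  rewrite gexpr_evalX /= Zp_expg; apply: val_inj => /=.
  by rewrite modnMml mul1n (_ : 2 * n.+1 = m.+1)%N ?modnn //; lia.
move/(congr1 (pres_lift f)); rewrite (homX (pres_liftM fR)) (pres_liftE fR).
rewrite (hom1 (pres_liftM fR)) /= Zp_expg => /(congr1 val) /=.
by rewrite modnMml mul1n modn_small // /m; lia.
Qed.

Lemma tauX_cyclic : cyclic_subgroup (t ^+ n.+1) = [set 1; t ^+ n.+1]%classic.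
Proof.
set c := t ^+ n.+1; have c2 : c * c = 1.
  rewrite -expgnDr; have := pres_relE (@NB_N2 n.+1).
  by rewrite gexpr_evalX /= mul2n -addnn.
have cV : c^-1 = c by apply: mulg1_eq.
have cX k : c ^+ k = 1 \/ c ^+ k = c.
  elim: k => [|k [IH|IH]]; [by left|right|left]; by rewrite expgS IH ?mulg1.
apply/seteqP; split=> [x [k]|x [->|->]].
- by case: (cX k) => -> [] ->; rewrite ?invg1 ?cV; [left|left|right|right].
- by exists 0%N; left.
- by exists 1%N; left.
Qed.

End Necklace.

Local Open Scope classical_set_scope.
Local Open Scope card_scope.

Theorem theorem2p8 (n : nat) (hn : (2 < n)%N) :
  (exists zeta : {multiplicative NB n -> LB n}, is_zeta zeta) /\
  (forall zeta : {multiplicative NB n -> LB n}, is_zeta zeta ->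
     [/\ ker zeta = cyclic_subgroup (tau n ^+ n),
         cyclic_subgroup (tau n ^+ n) #= `I_2
       & central (cyclic_subgroup (tau n ^+ n))]).
Proof.
case: n hn => [//|n]; rewrite ltnS => n_gt1.
split=> [|zeta zetaP]; first exact: zeta_exists.
split; first exact: zeta_kerE.
  rewrite tauX_cyclic.
  have -> : [set 1; tau n.+1 ^+ n.+1] =
      (fun i => if i == 0%N then 1 else tau n.+1 ^+ n.+1) @` `I_2.
    apply/seteqP; split=> [x [->|->]|_ [[|i] _ <-]].
    - by exists 0%N.
    - by exists 1%N.
    - by left.
    - by right.
  apply: inj_card_eq => i j; rewrite !inE /= => i2 j2.
  have c1 := tauX_neq1 n_gt1; have c1' := nesym c1.
  by move: i j i2 j2 => [|[|//]] [|[|//]].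
move=> x y; rewrite tauX_cyclic => -[->|->].
  exact/commute_sym/commute1.
exact: tau_central.
Qed.
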